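(* Let $(E,\|\cdot\|_E)$ be a real Banach space of Rademacher type $p\in[1,2]$. Let $q\in[p,\infty)$, $k,M\in\mathbb{N}$ and let $\xi_1,\ldots,\xi_M\in L_{kq}(\Omega;E)$ be independent and identically distributed $E$-valued random variables. Set $C^{\mathsf{SL}}_{q,p,k}:=2\bigl(2kK_{q,p}\tau_p(E)+B_q\bigr)$. Then, for every $U\in\otimes^{k,s}_{\varepsilon_s}E$, $$\Bigl\| U-\frac1M\sum_{j=1}^M \otimes^k\xi_j\Bigr\|_{L_q(\Omega;\otimes^{k,s}_{\varepsilon_s}E)}\le \bigl\|U-\mathbb{M}^k_\varepsilon[\xi_1]\bigr\|_{\varepsilon_s}+C^{\mathsf{SL}}_{q,p,k}\,M^{-\left(1-\frac1p\right)}\,\|\xi_1\|_{L_{kq}(\Omega;E)}^k.$$ In particular, for all $\eta\in L_k(\Omega;E)$, $$\Bigl\| \mathbb{M}^k_\varepsilon[\eta]-\frac1M\sum_{j=1}^M \otimes^k\xi_j\Bigr\|_{L_q(\Omega;\otimes^{k,s}_{\varepsilon_s}E)}\le \|\eta-\xi_1\|_{L_k(\Omega;E)}\sum_{i=0}^{k-1}\Bigl[\|\eta\|_{L_k(\Omega;E)}^i\|\xi_1\|_{L_k(\Omega;E)}^{k-i-1}\Bigr]+C^{\mathsf{SL}}_{q,p,k}\,M^{-\left(1-\frac1p\right)}\,\|\xi_1\|_{L_{kq}(\Omega;E)}^k.$$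
   Context: $(\Omega,\mathcal{A},\mathbb{P})$ is a complete probability space with expectation $\mathbb{E}$. For a real Banach space $F$ and $q\in[1,\infty)$, $L_q(\Omega;F)$ is the space of (classes of) Bochner measurable $\eta\colon\Omega\to F$ with $\|\eta\|_{L_q(\Omega;F)}:=(\mathbb{E}[\|\eta\|_F^q])^{1/q}<\infty$. $E'$ is the dual of $E$ and $B_{E'}$ its closed unit ball. Zeroth powers equal $1$. Tensor products: $\otimes^kE$ is the $k$-fold algebraic tensor product, $\otimes^k x:=x\otimes\cdots\otimes x$ ($k$ times), and $\otimes^{k,s}E$ is the symmetric $k$-fold algebraic tensor product, i.e. the set of finite sums $U=\sum_{j=1}^M\lambda_j\otimes^kx_j$ with $\lambda_j\in\mathbb{R}$, $x_j\in E$. The injective norm of $U=\sum_{j} x_{j,1}\otimes\cdots\otimes x_{j,k}\in\otimes^kE$ is $\|U\|_\varepsilon:=\sup\{|\sum_j\prod_{n=1}^kf_n(x_{j,n})|: f_1,\ldots,f_k\in B_{E'}\}$; the symmetric injective norm of $U=\sum_j\lambda_j\otimes^kx_j\in\otimes^{k,s}E$ is $\|U\|_{\varepsilon_s}:=\sup\{|\sum_j\lambda_jf(x_j)^k|: f\in B_{E'}\}$. $\otimes^k_\varepsilon E$ and $\otimes^{k,s}_{\varepsilon_s}E$ are the completions of $\otimes^kE$ and $\otimes^{k,s}E$ in these norms; the two norms are equivalent on symmetric tensors. For $\xi\in L_k(\Omega;E)$ the injective $k$th moment is the Bochner integral $\mathbb{M}^k_\varepsilon[\xi]:=\mathbb{E}[\otimes^k\xi]$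 in $\otimes^k_\varepsilon E$; it belongs to $\otimes^{k,s}_{\varepsilon_s}E$. Constants: a Rademacher family is a family of independent random variables $r_j$ with values in $\{-1,1\}$, each value having probability $\tfrac12$, on a complete probability space $(\widetilde\Omega,\widetilde{\mathcal A},\widetilde{\mathbb P})$. $K_{q,p}$ (Kahane--Khintchine constant, $p,q\in[1,\infty)$) is the smallest $K\in(0,\infty)$ with $\|\sum_{j=1}^nr_jx_j\|_{L_q(\widetilde\Omega;F)}\le K\|\sum_{j=1}^nr_jx_j\|_{L_p(\widetilde\Omega;F)}$ for all Rademacher families, all real Banach spaces $F$, all $n$ and all $x_j\in F$. $F$ has Rademacher type $p\in[1,2]$ if there is $\tau\in(0,\infty)$ with $\|\sum_{j=1}^nr_jx_j\|_{L_p(\widetilde\Omega;F)}\le\tau(\sum_{j=1}^n\|x_j\|_F^p)^{1/p}$ for all Rademacher families, all $n$ and all $x_j\in F$; the smallest such $\tau$ is $\tau_p(F)$. $B_q\in(0,\infty)$ is a constant depending only on $q$ for which the classical Khintchine inequality $\|\sum_{j=1}^nr_ja_j\|_{L_q(\widetilde\Omega;\mathbb{R})}\le B_q(\sum_{j=1}^na_j^2)^{1/2}$ holds for all finite real sequences $(a_j)$ and all Rademacher families. *)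

(* Defs.v *)
From HB Require Import structures.
From mathcomp Require Import all_boot all_order all_algebra.
From mathcomp Require Import all_classical all_reals all_analysis.
From mathcomp Require Import ring.

Set Implicit Arguments.
Unset Strict Implicit.
Unset Printing Implicit Defensive.

Import Order.TTheory GRing.Theory Num.Theory.
Import numFieldNormedType.Exports.

Local Open Scope classical_set_scope.
Local Open Scope quotient_scope.
Local Open Scope ring_scope.

Record seminorm (R : realType) (X : lmodType R) := Seminorm {
  seminorm_fun :> X -> R;
  seminormD : forall x y, seminorm_fun (x + y) <= seminorm_fun x + seminorm_fun y;
  seminormZ : forall a x, seminorm_fun (a *: x) = `|a| * seminorm_fun x }.

Section SeminormTheory.
Context (R : realType) (X : lmodType R) (N : seminorm X).

Lemma seminorm0 : N 0 = 0.
Proof. by rewrite -(scale0r 0) seminormZ normr0 mul0r. Qed.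

Lemma seminormN x : N (- x) = N x.
Proof. by rewrite -scaleN1r seminormZ normrN normr1 mul1r. Qed.

Lemma seminorm_ge0 x : 0 <= N x.
Proof.
have := seminormD N x (- x); rewrite subrr seminorm0 seminormN -mulr2n.
by rewrite pmulrn_lge0.
Qed.

Lemma seminorm_distC x y : N (x - y) = N (y - x).
Proof. by rewrite -opprB seminormN. Qed.

Lemma seminorm_dist x y z : N (x - z) <= N (x - y) + N (y - z).
Proof. by have := seminormD N (x - y) (y - z); rewrite addrA subrK. Qed.

Lemma seminorm_lip x y : `|N x - N y| <= N (x - y).
Proof.
have h u v : N u - N v <= N (u - v).
  by have := seminormD N (u - v) v; rewrite subrK lerBlDr.
by rewrite ler_norml h lerNl opprB seminorm_distC h.
Qed.

End SeminormTheory.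

(* The completion of (X, N): Cauchy sequences modulo null sequences.  If N is
   only a seminorm this is the completion of the Hausdorff quotient X / ker N. *)
Section Completion.
Context (R : realType) (X : lmodType R) (N : seminorm X).

Definition is_cauchy_seq : {pred nat -> X} := fun u => `[< forall e : R, 0 < e ->
  exists n0 : nat, forall i j : nat, (n0 <= i)%N -> (n0 <= j)%N -> N (u i - u j) < e >].

Lemma is_cauchy_seq_submod : submod_closed is_cauchy_seq.
Proof.
split=> [|a u v /asboolP hu /asboolP hv]; apply/asboolP => e e0.
  by exists 0%N => i j _ _; rewrite subrr seminorm0.
have a1 : 0 < `|a| + 1 by rewrite ltr_wpDl.
have [n hn] := hu (e / 2 / (`|a| + 1)) (divr_gt0 (divr_gt0 e0 (ltr0Sn R 1)) a1).
have [m hm] := hv (e / 2) (divr_gt0 e0 (ltr0Sn R 1)).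
exists (maxn n m) => i j; rewrite !geq_max => /andP[ni mi] /andP[nj mj].
have -> : (a *: u + v) i - (a *: u + v) j = a *: (u i - u j) + (v i - v j).
  by rewrite scalerBr opprD addrACA.
apply: (le_lt_trans (seminormD _ _ _)); rewrite (splitr e) seminormZ.
apply: ler_ltD; last exact: hm.
have := hn _ _ ni nj; rewrite ltr_pdivlMr// => /ltW; apply: le_trans.
by rewrite mulrC ler_wpM2l ?seminorm_ge0// lerDl.
Qed.

HB.instance Definition _ :=
  GRing.isSubmodClosed.Build R (nat -> X) is_cauchy_seq is_cauchy_seq_submod.

Record cauchy_seq := CauchySeq {
  cauchy_seq_val :> nat -> X;
  cauchy_seqP : cauchy_seq_val \in is_cauchy_seq }.

HB.instance Definition _ := [isSub for cauchy_seq_val].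
HB.instance Definition _ := [Choice of cauchy_seq by <:].
HB.instance Definition _ := [SubChoice_isSubLmodule of cauchy_seq by <:].

Definition is_null_seq : {pred cauchy_seq} := fun u => `[< forall e : R, 0 < e ->
  exists n0 : nat, forall i : nat, (n0 <= i)%N -> N (u i) < e >].

Lemma is_null_seqZ a u : u \in is_null_seq -> a *: u \in is_null_seq.
Proof.
move=> /asboolP hu; apply/asboolP => e e0.
have a1 : 0 < `|a| + 1 by rewrite ltr_wpDl.
have [n hn] := hu (e / (`|a| + 1)) (divr_gt0 e0 a1).
exists n => i ni; have := hn _ ni; rewrite ltr_pdivlMr//; apply: le_lt_trans.
by rewrite [X in N X]/= seminormZ mulrC ler_wpM2l ?seminorm_ge0// lerDl.
Qed.

Lemma is_null_seq_zmod : zmod_closed is_null_seq.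
Proof.
split=> [|u v /asboolP hu /asboolP hv]; apply/asboolP => e e0.
  by exists 0%N => i _; rewrite seminorm0.
have [n hn] := hu (e / 2) (divr_gt0 e0 (ltr0Sn R 1)).
have [m hm] := hv (e / 2) (divr_gt0 e0 (ltr0Sn R 1)).
exists (maxn n m) => i; rewrite !geq_max => /andP[ni mi].
apply: (le_lt_trans (seminormD _ _ _)); rewrite seminormN (splitr e).
by rewrite ltrD// ?hn// hm.
Qed.

HB.instance Definition _ :=
  GRing.isZmodClosed.Build cauchy_seq is_null_seq is_null_seq_zmod.

Definition completion : Type := Quotient.quot is_null_seq.

HB.instance Definition _ := GRing.Zmodule.on completion.

Definition completion_class (u : cauchy_seq) : completion := \pi_(Quotient.quot is_null_seq) u.

Lemma completion_eqP u v :
  reflect (completion_class u = completion_class v) (u - v \in is_null_seq).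
Proof. by rewrite Quotient.idealrBE; exact: eqP. Qed.

Lemma completion_classD : {morph completion_class : u v / u + v}.
Proof. by move=> u v; rewrite /completion_class !piE. Qed.

Lemma completion_class_repr (x : completion) : completion_class (repr x) = x.
Proof. exact: reprK. Qed.

Definition completion_scale a (x : completion) := completion_class (a *: repr x).

Lemma completion_classZ a u :
  completion_scale a (completion_class u) = completion_class (a *: u).
Proof.
apply/completion_eqP; rewrite -scalerBr; apply: is_null_seqZ.
by apply/completion_eqP; rewrite completion_class_repr.
Qed.

Fact completion_scaleA a b (x : completion) :
  completion_scale a (completion_scale b x) = completion_scale (a * b) x.
Proof.
by rewrite -(completion_class_repr x) !completion_classZ scalerA.
Qed.

Fact completion_scale1 : left_id 1 completion_scale.
Proof.
by move=> x; rewrite -(completion_class_repr x) completion_classZ scale1r.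
Qed.

Fact completion_scaleDr : right_distributive completion_scale +%R.
Proof.
move=> a x y; rewrite -(completion_class_repr x) -(completion_class_repr y).
by rewrite -completion_classD !completion_classZ scalerDr completion_classD.
Qed.

Fact completion_scaleDl x : {morph completion_scale^~ x : a b / a + b}.
Proof.
move=> a b; rewrite -(completion_class_repr x) !completion_classZ scalerDl.
by rewrite completion_classD.
Qed.

HB.instance Definition _ := GRing.Zmodule_isLmodule.Build R completion
  completion_scaleA completion_scale1 completion_scaleDr completion_scaleDl.

Definition completion_norm (x : completion) : R := limn (fun i => N (repr x i)).

Lemma cauchy_seqE (u : cauchy_seq) (e : R) : 0 < e ->
  exists n0 : nat, forall i j : nat, (n0 <= i)%N -> (n0 <= j)%N -> N (u i - u j) < e.
Proof. by move: e; apply/asboolP; exact: cauchy_seqP. Qed.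

Lemma is_cvg_seminorm_cauchy (u : cauchy_seq) : cvgn (fun i => N (u i)).
Proof.
apply/cauchy_cvgP/cauchy_exP => e e0.
have [n hn] := cauchy_seqE u e0.
exists (N (u n)); exists n => // i /= ni; rewrite /ball/=.
exact: le_lt_trans (seminorm_lip _ _ _) (hn _ _ (leqnn n) ni).
Qed.

Lemma cvg_completion_norm (u : cauchy_seq) :
  N (u i) @[i --> \oo] --> completion_norm (completion_class u).
Proof.
set v := repr (completion_class u).
have /asboolP vu : v - u \in is_null_seq.
  by apply/completion_eqP; rewrite completion_class_repr.
have -> : (fun i => N (u i)) = (fun i => N (v i) + (N (u i) - N (v i))).
  by apply/funext => i; rewrite addrC subrK.
rewrite -[completion_norm _]addr0; apply: cvgD.
  exact: is_cvg_seminorm_cauchy.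
apply/cvgr0Pnorm_lt => e e0; have [n hn] := vu e e0.
exists n => // i /= ni; apply: (le_lt_trans (seminorm_lip _ _ _)).
by rewrite seminorm_distC hn.
Qed.

Arguments cvg_completion_norm : clear implicits.

Lemma completion_normE (u : cauchy_seq) r :
  N (u i) @[i --> \oo] --> r -> completion_norm (completion_class u) = r.
Proof.
move/cvg_lim => <- //; apply/esym/cvg_lim => //; exact: (cvg_completion_norm _).
Qed.

Fact completion_normD (x y : completion) :
  completion_norm (x + y) <= completion_norm x + completion_norm y.
Proof.
rewrite -(completion_class_repr x) -(completion_class_repr y).
set u := repr x; set v := repr y; rewrite -completion_classD.
have h := cvgD (cvg_completion_norm u) (cvg_completion_norm v).
apply: (ler_cvg_to (cvg_completion_norm (u + v)) (h _)).
by apply: nearW => i; exact: (seminormD N (u i) (v i)).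
Qed.

Fact completion_normZ a (x : completion) :
  completion_norm (a *: x) = `|a| * completion_norm x.
Proof.
rewrite -(completion_class_repr x); set u := repr x.
rewrite [_ *: _]completion_classZ; apply: completion_normE.
have -> : (fun i => N ((a *: u) i)) = (fun i => `|a| * N (u i)).
  by apply/funext => i; exact: seminormZ.
by apply: cvgMr; exact: (cvg_completion_norm _).
Qed.

Fact completion_norm_eq0 (x : completion) : completion_norm x = 0 -> x = 0.
Proof.
rewrite -(completion_class_repr x) => x0.
have <- : completion_class 0 = 0 by rewrite /completion_class !piE.
apply/completion_eqP; rewrite subr0; apply/asboolP => e e0.
have := cvg_completion_norm (repr x); rewrite x0 => /cvgr0Pnorm_lt/(_ e e0).
case=> n _ hn; exists n => i ni.
exact: le_lt_trans (ler_norm _) (hn _ ni).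
Qed.

HB.instance Definition _ := Lmodule_isNormed.Build R completion
  completion_normD completion_normZ completion_norm_eq0.

Fact is_cauchy_seq_cst (x : X) : (fun=> x) \in is_cauchy_seq.
Proof.
by apply/asboolP => e e0; exists 0%N => i j _ _; rewrite subrr seminorm0.
Qed.

Definition completion_in (x : X) : completion :=
  completion_class (CauchySeq (is_cauchy_seq_cst x)).

Fact completion_in_linear : linear completion_in.
Proof.
move=> a x y; rewrite [X in _ = X + _]completion_classZ -completion_classD.
by congr completion_class; exact: val_inj.
Qed.

HB.instance Definition _ :=
  GRing.isLinear.Build R X completion _ completion_in completion_in_linear.

Lemma completion_in_norm x : `|completion_in x| = N x.
Proof. by apply: completion_normE; exact: (cvg_cst (N x)). Qed.

Lemma cvg_completion_in (u : cauchy_seq) :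
  completion_in (u n) @[n --> \oo] --> completion_class u.
Proof.
apply/cvgrPdist_le => e e0; have [n hn] := cauchy_seqE u e0.
exists n => // m /= nm.
have -> : completion_class u - completion_in (u m) =
    completion_class (u - CauchySeq (is_cauchy_seq_cst (u m))).
  by rewrite /completion_in /completion_class !piE.
apply: (ler_cvg_to (cvg_completion_norm _) (cvg_cst e)).
by exists n => // i /= ni; rewrite ltW// hn.
Qed.

Arguments cvg_completion_in : clear implicits.

Lemma completion_in_dense (x : completion) (e : R) : 0 < e ->
  exists y, `|x - completion_in y| < e.
Proof.
move=> e0; have := cvg_completion_in (repr x).
rewrite completion_class_repr => /cvgrPdist_lt/(_ e e0)[n _ hn].
by exists (repr x n); apply: hn => /=.
Qed.

Lemma completion_complete (F : set_system completion) :
  ProperFilter F -> cauchy F -> cvg F.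
Proof.
move=> FF /cauchyP Fc.
have i0 n : 0 < n.+1%:R^-1 :> R by rewrite invr_gt0 ltr0n.
have [g hg] := choice (fun n => Fc _ (i0 n)).
have [x hx] := choice (fun n => completion_in_dense (g n) (i0 n)).
have gg n m : `|g n - g m| < n.+1%:R^-1 + m.+1%:R^-1.
  have [z [zn zm]] := filter_ex (filterI (hg n) (hg m)).
  rewrite -(subrK z (g n)) -addrA; apply: (le_lt_trans (ler_normD _ _)).
  move: zn zm; rewrite -!ball_normE /= => zn zm.
  by rewrite ltrD// distrC.
have xx n m : N (x n - x m) < 2 * n.+1%:R^-1 + 2 * m.+1%:R^-1.
  rewrite -completion_in_norm raddfB/=.
  have -> : completion_in (x n) - completion_in (x m) =
      (completion_in (x n) - g n) + (g n - g m) + (g m - completion_in (x m)).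
    by rewrite !addrA !subrK.
  have -> : 2 * n.+1%:R^-1 + 2 * m.+1%:R^-1 =
      n.+1%:R^-1 + (n.+1%:R^-1 + m.+1%:R^-1) + m.+1%:R^-1 :> R by ring.
  apply: (le_lt_trans (ler_normD _ _)); rewrite ltrD//.
  by apply: (le_lt_trans (ler_normD _ _)); rewrite ltrD// distrC.
have small e : 0 < e -> exists n0 : nat, forall n : nat, (n0 <= n)%N ->
    n.+1%:R^-1 < e :> R.
  move=> e0; have := @cvg_harmonic R => /cvgr0Pnorm_lt/(_ e e0)[n0 _ hn0].
  exists n0 => n nn; exact: le_lt_trans (ler_norm _) (hn0 _ nn).
have xC : x \in is_cauchy_seq.
  apply/asboolP => e e0; have [n0 hn0] := small (e / 4) (divr_gt0 e0 (ltr0Sn R 3)).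
  exists n0 => i j /hn0 ni /hn0 nj; apply: (lt_trans (xx i j)).
  have -> : e = 2 * (e / 4) + 2 * (e / 4) by field.
  by rewrite ltrD// ltr_pM2l.
have xl := cvg_completion_in (CauchySeq xC).
apply/cvg_ex; exists (completion_class (CauchySeq xC)).
apply/cvgrPdist_lt => e e0.
have [n1 hn1] := small (e / 3) (divr_gt0 e0 (ltr0Sn R 2)).
move/cvgrPdist_lt : xl => /(_ (e / 3) (divr_gt0 e0 (ltr0Sn R 2)))[n2 _ hn2].
pose n := maxn n1 n2.
apply: filterS (hg n) => z; rewrite -ball_normE /= => gz.
set l := completion_class _ in hn2 *.
have -> : l - z = (l - completion_in (x n)) + (completion_in (x n) - g n) + (g n - z).
  by rewrite !addrA !subrK.
have -> : e = e / 3 + e / 3 + e / 3 by field.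
have nn := hn1 _ (leq_maxl n1 n2).
apply: (le_lt_trans (ler_normD _ _)); rewrite ltrD//; last exact: lt_trans nn.
apply: (le_lt_trans (ler_normD _ _)); rewrite ltrD//.
  by apply: hn2; exact: leq_maxr.
by rewrite distrC; exact: lt_trans (hx n) nn.
Qed.

HB.instance Definition _ :=
  Uniform_isComplete.Build completion completion_complete.
End Completion.

Arguments cvg_completion_norm {R X N} u.
Arguments cvg_completion_in {R X N} u.

Section TensorPower.
Context (R : realType) (k : nat) (E : normedModType R).

Record multilinear_form := MultilinearForm {
  multilinear_fun :> ('I_k -> E) -> R;
  multilinear_funP : forall (i : 'I_k) (x : 'I_k -> E) (a : R) (u v : E),
    let subst w := fun j => if j == i then w else x j in
    multilinear_fun (subst (a *: u + v)) =
      a * multilinear_fun (subst u) + multilinear_fun (subst v) }.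

(* The elementary tensor x_0 (x) ... (x) x_(k-1) is realized as the evaluation
   functional phi |-> phi (x_0, ..., x_(k-1)) on k-linear forms, and the
   algebraic tensor power as the span of these functionals. *)
Definition is_tensor : {pred multilinear_form -> R} := fun U =>
  `[< exists s : seq (R * ('I_k -> E)),
      U = \sum_(t <- s) t.1 *: (fun phi : multilinear_form => phi t.2) >].

Lemma is_tensor_submod : submod_closed is_tensor.
Proof.
split=> [|a U V /asboolP[s ->] /asboolP[t ->]]; apply/asboolP.
  by exists [::]; rewrite big_nil.
exists ([seq (a * z.1, z.2) | z <- s] ++ t).
rewrite big_cat big_map scaler_sumr; congr (_ + _).
by apply: eq_bigr => z _; rewrite scalerA.
Qed.

HB.instance Definition _ :=
  GRing.isSubmodClosed.Build R (multilinear_form -> R) is_tensor is_tensor_submod.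

Record tensor_power := TensorPower {
  tensor_val :> multilinear_form -> R;
  tensor_valP : tensor_val \in is_tensor }.

HB.instance Definition _ := [isSub for tensor_val].
HB.instance Definition _ := [Choice of tensor_power by <:].
HB.instance Definition _ := [SubChoice_isSubLmodule of tensor_power by <:].

Fact elementary_tensorP (x : 'I_k -> E) :
  (fun phi : multilinear_form => phi x) \in is_tensor.
Proof. by apply/asboolP; exists [:: (1, x)]; rewrite big_seq1 scale1r. Qed.

Definition elementary_tensor (x : 'I_k -> E) : tensor_power :=
  TensorPower (elementary_tensorP x).

Definition is_sym_tensor : {pred tensor_power} := fun U =>
  `[< exists s : seq (R * E),
      U = \sum_(t <- s) t.1 *: elementary_tensor (fun=> t.2) >].

Lemma is_sym_tensor_submod : submod_closed is_sym_tensor.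
Proof.
split=> [|a U V /asboolP[s ->] /asboolP[t ->]]; apply/asboolP.
  by exists [::]; rewrite big_nil.
exists ([seq (a * z.1, z.2) | z <- s] ++ t).
rewrite big_cat big_map scaler_sumr; congr (_ + _).
by apply: eq_bigr => z _; rewrite scalerA.
Qed.

HB.instance Definition _ :=
  GRing.isSubmodClosed.Build R tensor_power is_sym_tensor is_sym_tensor_submod.

Record sym_tensor_power := SymTensorPower {
  sym_tensor_val :> tensor_power;
  sym_tensor_valP : sym_tensor_val \in is_sym_tensor }.

HB.instance Definition _ := [isSub for sym_tensor_val].
HB.instance Definition _ := [Choice of sym_tensor_power by <:].
HB.instance Definition _ := [SubChoice_isSubLmodule of sym_tensor_power by <:].

Fact diagonal_tensorP (x : E) : elementary_tensor (fun=> x) \in is_sym_tensor.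
Proof. by apply/asboolP; exists [:: (1, x)]; rewrite big_seq1 scale1r. Qed.

Definition diagonal_tensor (x : E) : sym_tensor_power :=
  SymTensorPower (diagonal_tensorP x).

Fact prod_form_multilinear (f : 'I_k -> {scalar E}) (i : 'I_k) (x : 'I_k -> E)
    (a : R) (u v : E) :
  let subst w := fun j => if j == i then w else x j in
  \prod_n f n (subst (a *: u + v) n) =
    a * (\prod_n f n (subst u n)) + \prod_n f n (subst v n).
Proof.
move=> subst; have h w : \prod_n f n (subst w n) =
    f i w * \prod_(n | n != i) f n (x n).
  rewrite (bigD1 i)//= {1}/subst eqxx; congr (_ * _).
  by apply: eq_bigr => n /negPf ni; rewrite /subst ni.
by rewrite !h linearP/= mulrDl mulrA.
Qed.

Definition prod_form (f : 'I_k -> {scalar E}) : multilinear_form :=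
  @MultilinearForm (fun x => \prod_n f n (x n)) (prod_form_multilinear f).

Lemma elementary_tensorE (s : seq (R * ('I_k -> E))) (phi : multilinear_form) :
  (\sum_(t <- s) t.1 *: elementary_tensor t.2 : tensor_power) phi =
  \sum_(t <- s) t.1 * phi t.2.
Proof. by elim: s => [|t s IH]; rewrite ?big_nil ?big_cons// -IH. Qed.

(* The second condition says that the dual norm of f is at most 1. *)
Definition dual_ball : set {scalar E} :=
  [set f | continuous (f : E -> R) /\ forall x : E, `|x| <= 1 -> `|f x| <= 1].

Lemma dual_ball_le f x : dual_ball f -> `|f x| <= `|x|.
Proof.
case=> _ f1; have [->|x0] := eqVneq x 0; first by rewrite linear0 !normr0.
have nx : 0 < `|x| by rewrite normr_gt0.
have := f1 (`|x|^-1 *: x).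
rewrite normrZ normfV normr_id mulVf ?gt_eqF// linearZ/= normrM normfV normr_id.
by move=> /(_ (lexx _)); rewrite mulrC ler_pdivrMr// mul1r.
Qed.

Lemma dual_ball0 : dual_ball (\0 : {scalar E}).
Proof. by split=> [x|x _]; [exact: cvg_cst|rewrite normr0]. Qed.

Definition inj_norm (U : tensor_power) : R :=
  sup [set `|U (prod_form f)| | f in [set f | forall n, dual_ball (f n)]].

Lemma inj_norm_has_sup (U : tensor_power) :
  has_sup [set `|U (prod_form f)| | f in [set f | forall n, dual_ball (f n)]].
Proof.
split.
  exists `|U (prod_form (fun=> \0))|; exists (fun=> \0) => //= _.
  exact: dual_ball0.
have /asboolP[s Us] := tensor_valP U.
exists (\sum_(t <- s) `|t.1| * \prod_n `|t.2 n|) => _ [f hf <-].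
rewrite Us fct_sumE; apply: (le_trans (ler_norm_sum _ _ _)).
apply: ler_sum => t _; rewrite normrM ler_wpM2l//= normr_prod.
by apply: ler_prod => n _; rewrite normr_ge0 dual_ball_le.
Qed.

Lemma inj_norm_ub (U : tensor_power) f : (forall n, dual_ball (f n)) ->
  `|U (prod_form f)| <= inj_norm U.
Proof.
by move=> hf; apply: (sup_upper_bound (inj_norm_has_sup U)); exists f.
Qed.

Lemma inj_norm_le (U : tensor_power) c :
  (forall f, (forall n, dual_ball (f n)) -> `|U (prod_form f)| <= c) ->
  inj_norm U <= c.
Proof.
move=> h; apply: ge_sup; first by have [] := inj_norm_has_sup U.
by move=> _ [f hf <-]; exact: h.
Qed.

Fact inj_normD U V : inj_norm (U + V) <= inj_norm U + inj_norm V.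
Proof.
apply: inj_norm_le => f hf.
by apply: (le_trans (ler_normD _ _)); rewrite lerD// inj_norm_ub.
Qed.

Fact inj_normZ a U : inj_norm (a *: U) = `|a| * inj_norm U.
Proof.
have h b V : inj_norm (b *: V) <= `|b| * inj_norm V.
  apply: inj_norm_le => f hf.
  by rewrite [X in `|X|]/= normrM ler_wpM2l// inj_norm_ub.
apply/eqP; rewrite eq_le h/=; have [->|a0] := eqVneq a 0.
  rewrite normr0 mul0r; apply: le_trans (inj_norm_ub _ (fun=> dual_ball0)).
  exact: normr_ge0.
rewrite mulrC -ler_pdivlMr ?normr_gt0// mulrC -normfV.
by rewrite -{1}(scalerK a0 U) h.
Qed.

Definition inj_seminorm : seminorm tensor_power := Seminorm inj_normD inj_normZ.

Definition sym_inj_norm (U : sym_tensor_power) : R :=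
  sup [set `|U (prod_form (fun=> f))| | f in dual_ball].

Lemma sym_inj_norm_has_sup (U : sym_tensor_power) :
  has_sup [set `|U (prod_form (fun=> f))| | f in dual_ball].
Proof.
split.
  by exists `|U (prod_form (fun=> \0))|; exists \0 => //; exact: dual_ball0.
by exists (inj_norm U) => _ [f hf <-]; exact: inj_norm_ub.
Qed.

Lemma sym_inj_norm_ub (U : sym_tensor_power) f : dual_ball f ->
  `|U (prod_form (fun=> f))| <= sym_inj_norm U.
Proof.
by move=> hf; apply: (sup_upper_bound (sym_inj_norm_has_sup U)); exists f.
Qed.

Lemma sym_inj_norm_le (U : sym_tensor_power) c :
  (forall f, dual_ball f -> `|U (prod_form (fun=> f))| <= c) ->
  sym_inj_norm U <= c.
Proof.
move=> h; apply: ge_sup; first by have [] := sym_inj_norm_has_sup U.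
by move=> _ [f hf <-]; exact: h.
Qed.

Fact sym_inj_normD U V : sym_inj_norm (U + V) <= sym_inj_norm U + sym_inj_norm V.
Proof.
apply: sym_inj_norm_le => f hf.
by apply: (le_trans (ler_normD _ _)); rewrite lerD// sym_inj_norm_ub.
Qed.

Fact sym_inj_normZ a U : sym_inj_norm (a *: U) = `|a| * sym_inj_norm U.
Proof.
have h b V : sym_inj_norm (b *: V) <= `|b| * sym_inj_norm V.
  apply: sym_inj_norm_le => f hf.
  by rewrite [X in `|X|]/= normrM ler_wpM2l// sym_inj_norm_ub.
apply/eqP; rewrite eq_le h/=; have [->|a0] := eqVneq a 0.
  rewrite normr0 mul0r; apply: le_trans (sym_inj_norm_ub _ dual_ball0).
  exact: normr_ge0.
rewrite mulrC -ler_pdivlMr ?normr_gt0// mulrC -normfV.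
by rewrite -{1}(scalerK a0 U) h.
Qed.

Definition sym_inj_seminorm : seminorm sym_tensor_power :=
  Seminorm sym_inj_normD sym_inj_normZ.

Definition inj_tensor_power := completion inj_seminorm.

Definition sym_inj_tensor_power := completion sym_inj_seminorm.

Definition tensor_pow (x : E) : inj_tensor_power :=
  completion_in inj_seminorm (elementary_tensor (fun=> x)).

Definition sym_tensor_pow (x : E) : sym_inj_tensor_power :=
  completion_in sym_inj_seminorm (diagonal_tensor x).

(* On symmetric tensors the two norms are equivalent, so that the completion of
   the symmetric tensors in the symmetric norm is identified with their closure
   in the injective tensor power: m and m' are the same element when they are
   limits of one sequence of symmetric tensors. *)
Definition same_tensor (m : sym_inj_tensor_power) (m' : inj_tensor_power) : Prop :=
  exists u : nat -> sym_tensor_power,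
    completion_in sym_inj_seminorm (u n) @[n --> \oo] --> m /\
    completion_in inj_seminorm (u n) @[n --> \oo] --> m'.
End TensorPower.

Section Bochner.
Context (R : realType) (d : measure_display) (Omega : measurableType d).
Context (P : probability Omega R).

Definition simple_rv (F : normedModType R) (s : Omega -> F) : Prop :=
  finite_set (range s) /\ forall y : F, measurable (s @^-1` [set y]).

Definition simple_expectation (F : normedModType R) (s : Omega -> F) : F :=
  \sum_(y \in range s) fine (P (s @^-1` [set y])) *: y.

Definition bochner_measurable (F : normedModType R) (f : Omega -> F) : Prop :=
  exists s : nat -> Omega -> F, (forall n, simple_rv (s n)) /\
    {ae P, forall w, s n w @[n --> \oo] --> f w}.

Definition Lq_norm (F : normedModType R) (q : R) (f : Omega -> F) : \bar R :=
  'N[P]_(q%:E)[(fun w => `|f w|%:E)].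

Definition in_Lq (F : normedModType R) (q : R) (f : Omega -> F) : Prop :=
  bochner_measurable f /\ (Lq_norm q f < +oo)%E.

Definition is_bochner_integral (F : normedModType R) (f : Omega -> F) (v : F) : Prop :=
  bochner_measurable f /\
  exists s : nat -> Omega -> F, [/\ forall n, simple_rv (s n),
    (\int[P]_w (`|f w - s n w|%:E))%E @[n --> \oo] --> 0%E &
    simple_expectation (s n) @[n --> \oo] --> v].

(* Junk value 0 if f is not Bochner integrable. *)
Definition bochner_integral (F : normedModType R) (f : Omega -> F) : F :=
  xget 0 [set v | is_bochner_integral f v].

Definition borel_set (F : topologicalType) : set (set F) := <<s @open F >>.

Definition independent_rvs (I : finType) (F : topologicalType)
    (X : I -> Omega -> F) : Prop :=
  forall (J : {set I}) (A : I -> set F), (forall i, borel_set (A i)) ->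
    P (\bigcap_(i in [set` J]) X i @^-1` A i) =
    (\prod_(i in J) P (X i @^-1` A i))%E.

Definition identically_distributed (I : Type) (F : topologicalType)
    (X : I -> Omega -> F) : Prop :=
  forall (i j : I) (A : set F), borel_set A -> P (X i @^-1` A) = P (X j @^-1` A).

Definition rademacher_family (I : finType) (r : I -> Omega -> R) : Prop :=
  [/\ forall i, measurable_fun setT (r i),
      forall i w, r i w = 1 \/ r i w = -1,
      forall i, P [set w | r i w = 1] = (2^-1)%:E /\
                P [set w | r i w = -1] = (2^-1)%:E &
      independent_rvs r].

Definition inj_moment (k : nat) (E : normedModType R) (xi : Omega -> E) :
    inj_tensor_power k E :=
  bochner_integral (fun w => tensor_pow k (xi w)).

(* The injective moment, seen in the completion of the symmetric tensors. *)
Definition sym_inj_moment (k : nat) (E : normedModType R) (xi : Omega -> E) :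
    sym_inj_tensor_power k E :=
  xget 0 [set m | same_tensor m (inj_moment k xi)].
End Bochner.

Section Constants.
Context (R : realType).

Definition kahane_khintchine_bound (q p K : R) : Prop :=
  forall (d : measure_display) (T : measurableType d) (P : probability T R)
    (n : nat) (r : 'I_n -> T -> R) (F : completeNormedModType R) (x : 'I_n -> F),
  measure_is_complete P -> rademacher_family P r ->
  (Lq_norm P q (fun w => (\sum_(j < n) r j w *: x j)%R) <=
   K%:E * Lq_norm P p (fun w => (\sum_(j < n) r j w *: x j)%R))%E.

(* The best constant, as an infimum in [0, +oo]: it is finite by the
   Kahane-Khintchine theorem, and attained. *)
Definition kahane_khintchine (q p : R) : \bar R :=
  ereal_inf [set K%:E | K in [set K | 0 < K /\ kahane_khintchine_bound q p K]].

Definition type_bound (E : normedModType R) (p tau : R) : Prop :=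
  forall (d : measure_display) (T : measurableType d) (P : probability T R)
    (n : nat) (r : 'I_n -> T -> R) (x : 'I_n -> E),
  measure_is_complete P -> rademacher_family P r ->
  (Lq_norm P p (fun w => (\sum_(j < n) r j w *: x j)%R) <=
   (tau * (\sum_(j < n) `|x j| `^ p) `^ p^-1)%:E)%E.

Definition rademacher_type (E : normedModType R) (p : R) : Prop :=
  exists2 tau : R, 0 < tau & type_bound E p tau.

(* An infimum rather than a minimum because for E = {0} every tau > 0 is
   admissible. *)
Definition type_constant (E : normedModType R) (p : R) : \bar R :=
  ereal_inf [set tau%:E | tau in [set tau | 0 < tau /\ type_bound E p tau]].

Definition khintchine_bound (q B : R) : Prop :=
  forall (d : measure_display) (T : measurableType d) (P : probability T R)
    (n : nat) (r : 'I_n -> T -> R) (a : 'I_n -> R),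
  measure_is_complete P -> rademacher_family P r ->
  (Lq_norm P q (fun w => (\sum_(j < n) r j w * a j)%R : R^o) <=
   (B * Num.sqrt (\sum_(j < n) a j ^+ 2))%:E)%E.

Definition SL_constant (E : normedModType R) (B q p : R) (k : nat) : \bar R :=
  (2%:E * ((2 * k%:R)%:E * kahane_khintchine q p * type_constant E p + B%:E))%E.
End Constants.

(* Main.v *)
(* Symmetrization and contraction. Discretizing E by a nearest-point map g_n onto
   finitely many points (with Borel fibres, 0 among the points, the points dense in
   the essential ranges) turns the law of (xi_1, ..., xi_M) into a product of finite
   laws and all expectations into finite sums. There an independent copy and Jensen's
   inequality bound the L_q error by twice the L_q mean of
   M^-1 sum_j e_j x_j^(k) over random signs e_j. For f in the dual ball the scalars
   f(x_j)^k are Lipschitz images of b_j = k |x_j|^(k-1) f(x_j), vanishing with b_j;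
   the comparison principle replaces them by b_j, which leaves a Rademacher sum in
   E, controlled by the Kahane-Khintchine and type constants, and the power mean
   inequality gives the rate. Fatou's lemma lets n tend to infinity. The second bound
   follows with U a moment, the distance of two moments being bounded by Hoelder. *)

Require Import Defs.
From HB Require Import structures.
From mathcomp Require Import all_boot all_order all_algebra.
From mathcomp Require Import all_classical all_reals all_analysis.
From mathcomp Require Import measurable_realfun ring lra zify.

Set Implicit Arguments.
Unset Strict Implicit.
Unset Printing Implicit Defensive.

Import Order.TTheory GRing.Theory Num.Theory.
Import numFieldNormedType.Exports.

Local Open Scope classical_set_scope.
Local Open Scope ring_scope.

(** * Powers and convexity *)

(** The obstacle is that E may be nonseparable and that the samples live in a completion: an
    independent copy, Fubini and suprema over the dual ball would have to be made measurable on
    infinite spaces. For finite laws all of these are finite sums, and independence is used on Borel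
    cells only. The passage to the limit asks little: Fatou needs only almost sure convergence of
    the error, while the bound depends on a single scalar moment.

    The comparison principle is proved one sign at a time. With the other signs fixed, the two
    values of one sign give the suprema of a + c and a - c, and the claim becomes a majorization
    between two pairs of reals. As b_j is linear in f, the functional finally disappears through
    |f(x)| <= |x|.

    In the constant, symmetrization contributes 2, the passage from suprema of sums to suprema of
    absolute values 2^(1/q) <= 2, and the derivative of t^k on [-|x_j|, |x_j|] the factor k. This is
    the summand 2 * 2k K tau of C. The constants K and tau are infima in [0, +oo], so the products 0
    * oo must be sorted out at the end. *)

Section PowerInequalities.
Context (R : realType).
Implicit Types (a b q s t x y : R).

Lemma eq_ler x y : x = y -> x <= y. Proof. by move=> ->. Qed.

(** The supporting line of x^q at a is Young's inequality for x and a^(q-1) with exponents q and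
    q/(q-1). The case q = 1 is separate because the conjugate exponent is then infinite. *)
Lemma powR_tangent q a x : 1 <= q -> 0 <= a -> 0 <= x ->
  a `^ q + q * a `^ (q - 1) * (x - a) <= x `^ q.
Proof.
move=> q1 a0 x0; have q0 : 0 < q by exact: lt_le_trans q1.
have aq : a * a `^ (q - 1) = a `^ q by rewrite mulr_powRB1.
have [->|q_neq1] := eqVneq q 1.
  by rewrite subrr powRr0 !powRr1// !mul1r addrC subrK.
have q1' : 0 < q - 1 by rewrite subr_gt0 lt_neqAle eq_sym q_neq1.
have q10 : q - 1 != 0 by rewrite gt_eqF.
have qq0 : q != 0 by rewrite gt_eqF.
have := @conjugate_powR R x (a `^ (q - 1)) q (q / (q - 1)) x0 (powR_ge0 _ _) q0.
rewrite divr_gt0// => /(_ isT); rewrite invf_div.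
have -> : q^-1 + (q - 1) / q = 1 by field.
have -> : (a `^ (q - 1)) `^ (q / (q - 1)) = a `^ q.
  by rewrite -powRrM; congr (_ `^ _); field.
move=> /(_ erefl).
rewrite -(ler_pM2l q0) => young.
rewrite -lerBrDl; apply: le_trans (_ : q * (x * a `^ (q - 1)) - q * a `^ q <= _).
  by rewrite -aq; apply: eq_ler; ring.
rewrite lerBlDr; apply: (le_trans young).
by apply: eq_ler; field.
Qed.

(** Averaging the tangent inequality at the mean [a] makes its linear term vanish. *)
Lemma powR_jensen (I : finType) (w x : I -> R) q : 1 <= q ->
  (forall i, 0 <= w i) -> \sum_i w i = 1 -> (forall i, 0 <= x i) ->
  (\sum_i w i * x i) `^ q <= \sum_i w i * x i `^ q.
Proof.
move=> q1 w0 w1 x0; set a := \sum_i w i * x i.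
have a0 : 0 <= a by apply: sumr_ge0 => i _; rewrite mulr_ge0.
have : \sum_i w i * (a `^ q + q * a `^ (q - 1) * (x i - a)) <=
    \sum_i w i * x i `^ q.
  by apply: ler_sum => i _; rewrite ler_wpM2l// powR_tangent.
apply: le_trans; apply: eq_ler.
have -> : \sum_i w i * (a `^ q + q * a `^ (q - 1) * (x i - a)) =
    a `^ q * \sum_i w i + q * a `^ (q - 1) * (a - a * \sum_i w i).
  rewrite !mulr_sumr -sumrB mulr_sumr -big_split/=.
  by apply: eq_bigr => i _; ring.
by rewrite w1 !mulr1 subrr mulr0 addr0.
Qed.

(** By symmetry s <= t and b <= a. If b <= s, monotonicity suffices. Otherwise s < b <= a <= t: the
    tangents at a and b bound the gain from a to t below and the loss from b to s above, the slope
    at a is the larger one, and t - a >= b - s. *)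
Lemma powR_majorization q a b s t : 1 <= q ->
  0 <= a -> 0 <= b -> 0 <= s -> 0 <= t ->
  a <= Num.max s t -> b <= Num.max s t -> a + b <= s + t ->
  a `^ q + b `^ q <= s `^ q + t `^ q.
Proof.
move=> q1; have q0 : 0 <= q by exact: le_trans q1.
wlog st : s t / s <= t.
  move=> H a0 b0 s0 t0; have [st|/ltW ts] := lerP s t.
    by move: (H s t st); rewrite max_r//; apply.
  move=> am bm ab; rewrite [leRHS]addrC; apply: H => //; rewrite ?max_r//.
  by rewrite [leRHS]addrC.
wlog ba : a b / b <= a.
  move=> H a0 b0 s0 t0 am bm ab; have [ba|/ltW ba] := leP b a; first exact: H.
  by rewrite [leLHS]addrC; apply: H => //; rewrite [leLHS]addrC.
move=> a0 b0 s0 t0; rewrite max_r// => at_ bt ab.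
have [bs|sb] := leP b s.
  by rewrite addrC; apply: lerD; apply: ge0_ler_powR; rewrite ?nnegrE.
have hA := powR_tangent q1 a0 t0; have hB := powR_tangent q1 b0 s0.
have : q * b `^ (q - 1) * (b - s) <= q * a `^ (q - 1) * (t - a).
  apply: ler_pM.
  - by rewrite mulr_ge0 ?powR_ge0.
  - by rewrite subr_ge0 ltW.
  - by rewrite ler_wpM2l// ge0_ler_powR ?nnegrE// subr_ge0.
  - by lra.
by move: hA hB; lra.
Qed.

Lemma powR_add_le q x y : 1 <= q -> 0 <= x -> 0 <= y ->
  (x + y) `^ q <= 2 `^ (q - 1) * (x `^ q + y `^ q).
Proof.
move=> q1 x0 y0; have q0 : 0 < q by exact: lt_le_trans q1.
have := @powR_jensen bool (fun=> 2^-1) (fun c : bool => if c then x else y) q q1.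
rewrite !big_bool/= -!mulrDr.
have -> : 2^-1 + 2^-1 = 1 :> R by field.
move=> /(_ (fun=> ltac:(by rewrite invr_ge0))) /(_ erefl).
move=> /(_ (fun c => ltac:(by case: c))).
have half : (2^-1 : R) = 2 `^ (-1) by rewrite powR_inv1.
rewrite powRM ?addr_ge0//; rewrite {1}half -powRrM mulN1r powRN.
rewrite ler_pdivrMl ?powR_gt0// => /le_trans; apply.
rewrite half mulrA -powRD//.
by apply/implyP => _; rewrite pnatr_eq0.
Qed.

End PowerInequalities.

(** * The comparison principle *)

Section Comparison.
Context (R : realType) (F : Type) (D : set F) (f0 : F) (Df0 : D f0).

Definition supD (h : F -> R) : R := sup (h @` D).

(** [sup] has a default value on unbounded sets, hence the a priori bound C here and the bounds A, B
    in the lemmas below. *)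
Lemma supD_ub (h : F -> R) C : (forall f, D f -> h f <= C) ->
  forall f, D f -> h f <= supD h.
Proof.
move=> hC f Df; apply: sup_upper_bound; last by exists f.
by split; [exists (h f), f | exists C => _ [g Dg <-]; exact: hC].
Qed.

Lemma supD_le (h : F -> R) C : (forall f, D f -> h f <= C) -> supD h <= C.
Proof.
move=> hC; apply: ge_sup; first by exists (h f0), f0.
by move=> _ [g Dg <-]; exact: hC.
Qed.

(* The pairs of suprema on the two sides are compared by weak majorization. *)
Lemma contraction_step q (a b c : F -> R) (A B : R) : 1 <= q ->
  a f0 = 0 -> b f0 = 0 -> c f0 = 0 ->
  (forall f, D f -> `|a f| <= A) -> (forall f, D f -> `|b f| <= B) ->
  (forall f, D f -> `|c f| <= `|b f|) ->
  (forall f g, D f -> D g -> `|c f - c g| <= `|b f - b g|) ->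
  supD (fun f => a f + c f) `^ q + supD (fun f => a f - c f) `^ q <=
  supD (fun f => a f + b f) `^ q + supD (fun f => a f - b f) `^ q.
Proof.
move=> q1 a0 b0 c0 aA bB cb lip.
have bdd (h : F -> R) : (forall f, D f -> `|h f| <= `|b f|) ->
    (forall f, D f -> a f + h f <= A + B) /\ (forall f, D f -> a f - h f <= A + B).
  move=> hb; split=> f Df; have := aA f Df; have := le_trans (hb f Df) (bB f Df);
    rewrite !ler_norml => /andP[h1 h2] /andP[h3 h4]; lra.
have [cp cn] := bdd c cb; have [bp bn] := bdd b (fun f _ => lexx _).
have ge0 h C : h f0 = 0 -> (forall f, D f -> h f <= C) -> 0 <= supD h.
  by move=> h0 hC; rewrite -h0; exact: (supD_ub hC).
have sp := supD_ub bp; have sn := supD_ub bn.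
set s := supD (fun f => a f + b f) in sp *.
set t := supD (fun f => a f - b f) in sn *.
(* The left side is the larger of a f + b f and a f - b f. *)
have ltc f : D f -> a f + `|b f| <= Num.max s t.
  move=> Df; rewrite le_max; have [_|_] := ger0P (b f); first by rewrite sp.
  by rewrite sn// orbT.
(* The sign of b f - b g decides which of f, g is inserted in the supremum with plus and which in
   the one with minus. This bounds the sum of the two suprema for c through the Lipschitz
   hypothesis. *)
have st f g : D f -> D g -> a f + a g + `|b f - b g| <= s + t.
  move=> Df Dg; have := sp f Df; have := sp g Dg; have := sn f Df; have := sn g Dg.
  by have [_|_] := ger0P (b f - b g); lra.
apply: powR_majorization => //.
- by apply: ge0 cp; rewrite a0 c0 addr0.
- by apply: ge0 cn; rewrite a0 c0 subr0.
- by apply: ge0 bp; rewrite a0 b0 addr0.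
- by apply: ge0 bn; rewrite a0 b0 subr0.
- apply: supD_le => f Df; apply: le_trans (ltc f Df); rewrite lerD2l.
  exact: le_trans (ler_norm _) (cb f Df).
- apply: supD_le => f Df; apply: le_trans (ltc f Df); rewrite lerD2l.
  by apply: le_trans (cb f Df); rewrite -normrN ler_norm.
rewrite -lerBrDr; apply: supD_le => f Df.
rewrite lerBrDr -lerBrDl; apply: supD_le => g Dg; rewrite lerBrDl.
apply: le_trans (st f g Df Dg); have := le_trans (ler_norm _) (lip f g Df Dg).
by lra.
Qed.

Context (n : nat).
Implicit Types (b c : 'I_n -> F -> R) (e : {ffun 'I_n -> bool}).

Definition signed_sum c e (f : F) : R := \sum_j (-1) ^+ e j * c j f.

Definition flip (j : 'I_n) e : {ffun 'I_n -> bool} :=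
  [ffun i => if i == j then ~~ e i else e i].

Lemma flipK j : involutive (flip j).
Proof. by move=> e; apply/ffunP => i; rewrite !ffunE; case: eqP => //; rewrite negbK. Qed.

Lemma sum_involution (h : {ffun 'I_n -> bool} -> {ffun 'I_n -> bool})
    (G : {ffun 'I_n -> bool} -> R) : involutive h ->
  2 * \sum_e G e = \sum_e (G e + G (h e)).
Proof.
move=> hK; rewrite big_split/= mulr2n mulrDl mul1r; congr (_ + _).
exact: (reindex_inj (inv_inj hK)).
Qed.

(** Pairing each e with its flip at j leaves the sum over the other coordinates as a common part
    [a], and [contraction_step] applies to each pair. The factor [s] absorbs the sign of e at j. *)
Lemma contraction_coordinate q j b c (B : 'I_n -> R) : 1 <= q ->
  (forall i, b i f0 = 0) -> c j f0 = 0 ->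
  (forall i, i != j -> c i = b i) ->
  (forall i f, D f -> `|b i f| <= B i) ->
  (forall f, D f -> `|c j f| <= `|b j f|) ->
  (forall f g, D f -> D g -> `|c j f - c j g| <= `|b j f - b j g|) ->
  \sum_e supD (signed_sum c e) `^ q <= \sum_e supD (signed_sum b e) `^ q.
Proof.
move=> q1 b0 c0 cj bB cb lip.
rewrite -(@ler_pM2l _ 2)// !(sum_involution _ (flipK j)); apply: ler_sum => e _.
pose a f := \sum_(i | i != j) (-1) ^+ e i * b i f.
pose s := (-1) ^+ e j : R.
have aE (h : 'I_n -> F -> R) : (forall i, i != j -> h i = b i) ->
    signed_sum h e = (fun f => a f + s * h j f) /\
    signed_sum h (flip j e) = (fun f => a f - s * h j f).
  move=> hb; split; apply/funext => f; rewrite /signed_sum (bigD1 j)//= addrC.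
    by congr (_ + _); apply: eq_bigr => i ij; rewrite hb.
  rewrite !ffunE eqxx signrN mulNr; congr (_ - _).
  by apply: eq_bigr => i ij; rewrite hb// ffunE (negPf ij).
have [-> ->] := aE c cj; have [-> ->] := aE b (fun _ _ => erefl).
have ns x : `|s * x| = `|x| by rewrite normrM normr_sign mul1r.
apply: (@contraction_step q a (fun f => s * b j f) (fun f => s * c j f)
  (\sum_i B i) (B j)) => //.
- by rewrite /a big1// => i _; rewrite b0 mulr0.
- by rewrite b0 mulr0.
- by rewrite c0 mulr0.
- move=> f Df; apply: (le_trans (ler_norm_sum _ _ _)).
  rewrite [leRHS](bigID (fun i => i != j))/= -[leLHS]addr0; apply: lerD.
    by apply: ler_sum => i _; rewrite normrM normr_sign mul1r bB.
  by apply: sumr_ge0 => i _; apply: le_trans (bB i f Df).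
- by move=> f Df; rewrite ns bB.
- by move=> f Df; rewrite !ns cb.
- by move=> f g Df Dg; rewrite -!mulrBr !ns lip.
Qed.

Lemma contraction_sup q b c (B : 'I_n -> R) : 1 <= q ->
  (forall i, b i f0 = 0) -> (forall i, c i f0 = 0) ->
  (forall i f, D f -> `|b i f| <= B i) ->
  (forall i f, D f -> `|c i f| <= `|b i f|) ->
  (forall i f g, D f -> D g -> `|c i f - c i g| <= `|b i f - b i g|) ->
  \sum_e supD (signed_sum c e) `^ q <= \sum_e supD (signed_sum b e) `^ q.
Proof.
move=> q1 b0 c0 bB cb lip.
(* Hybrid families: the first m entries come from b, the others from c, so each increment of m
   changes one coordinate. *)
pose mix m (i : 'I_n) := if (i < m)%N then b i else c i.
have mix0 : mix 0 = c by apply/funext.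
have mixn : mix n = b by apply/funext => i; rewrite /mix ltn_ord.
rewrite -mix0 -[in leRHS]mixn.
have : forall m, (m <= n)%N -> \sum_e supD (signed_sum (mix 0) e) `^ q <=
    \sum_e supD (signed_sum (mix m) e) `^ q; last exact.
elim=> // m IH mn; apply: (le_trans (IH (ltnW mn))).
have mixb i f : D f -> `|mix m.+1 i f| <= B i.
  by move=> Df; rewrite /mix; case: ifP => _; rewrite ?(le_trans (cb _ _ Df)) ?bB.
apply: (@contraction_coordinate q (Ordinal mn) (mix m.+1) (mix m) B) => //;
  rewrite /mix /= ?ltnn ?ltnSn//.
- by move=> i; case: ifP.
- move=> i im; rewrite ltnS [in RHS]leq_eqVlt.
  by move: im; rewrite -val_eqE/= => /negPf ->.
- exact: cb.
- exact: lip.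
Qed.

End Comparison.

(** An absolute supremum is the larger of the suprema for e and for -e; bounding the maximum of the
    q-th powers by their sum costs the factor 2 after summation over e. [N] is only assumed to lie
    below every bound of the c-sums and [N'] above the b-sums: [N] will be a tensor norm, and [N'] a
    norm in E that dominates its functionals. *)
Lemma contraction_abs_sup (R : realType) (F : Type) (D : set F) (f0 : F) (n : nat)
    q (b c : 'I_n -> F -> R) (B : 'I_n -> R) (N N' : {ffun 'I_n -> bool} -> R) : D f0 -> 1 <= q ->
  (forall i, b i f0 = 0) -> (forall i, c i f0 = 0) ->
  (forall i f, D f -> `|b i f| <= B i) ->
  (forall i f, D f -> `|c i f| <= `|b i f|) ->
  (forall i f g, D f -> D g -> `|c i f - c i g| <= `|b i f - b i g|) ->
  (forall e, 0 <= N e) ->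
  (forall e C, (forall f, D f -> `|signed_sum c e f| <= C) -> N e <= C) ->
  (forall e f, D f -> `|signed_sum b e f| <= N' e) ->
  \sum_e N e `^ q <= 2 * \sum_e N' e `^ q.
Proof.
move=> Df0 q1 b0 c0 bB cb lip N0 NC bN.
have q0 : 0 <= q by exact: le_trans q1.
pose S e := supD D (signed_sum c e).
have sumC e f : D f -> `|signed_sum c e f| <= \sum_i B i.
  move=> Df; apply: (le_trans (ler_norm_sum _ _ _)); apply: ler_sum => i _.
  by rewrite normrM normr_sign mul1r (le_trans (cb _ _ Df))// bB.
have sum0 (h : 'I_n -> F -> R) e : (forall i, h i f0 = 0) -> signed_sum h e f0 = 0.
  by move=> h0; rewrite /signed_sum big1// => i _; rewrite h0 mulr0.
have Sub e f : D f -> signed_sum c e f <= S e.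
  apply: supD_ub => g Dg; exact: le_trans (ler_norm _) (sumC e g Dg).
have S0 e : 0 <= S e by rewrite -(sum0 c e c0) Sub.
pose opp (e : {ffun 'I_n -> bool}) : {ffun 'I_n -> bool} := [ffun i => ~~ e i].
have oppK : involutive opp by move=> e; apply/ffunP => i; rewrite !ffunE negbK.
have sumN e f : signed_sum c (opp e) f = - signed_sum c e f.
  by rewrite /signed_sum -sumrN; apply: eq_bigr => i _; rewrite ffunE signrN mulNr.
have NS e : N e `^ q <= S e `^ q + S (opp e) `^ q.
  have [SS|SS] := leP (S e) (S (opp e)).
    apply: le_trans (_ : S (opp e) `^ q <= _); last by rewrite lerDr powR_ge0.
    rewrite ge0_ler_powR ?nnegrE//; apply: NC => f Df; rewrite ler_norml -lerNl -sumN.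
    by rewrite Sub//= (le_trans _ SS)// Sub.
  apply: le_trans (_ : S e `^ q <= _); last by rewrite lerDl powR_ge0.
  rewrite ge0_ler_powR ?nnegrE//; apply: NC => f Df; rewrite ler_norml lerNl -sumN.
  by rewrite Sub// andbT (le_trans _ (ltW SS))// Sub.
apply: le_trans (_ : 2 * \sum_e S e `^ q <= _).
  rewrite (sum_involution _ oppK).
  by apply: ler_sum => e _; exact: NS.
rewrite ler_wpM2l//.
apply: le_trans (contraction_sup Df0 q1 b0 c0 bB cb lip) _.
apply: ler_sum => e _; have N'0 : 0 <= N' e by apply: le_trans (bN e f0 Df0).
rewrite ge0_ler_powR ?nnegrE//.
  rewrite -(sum0 b e b0); apply: (@supD_ub _ _ D _ (N' e)) => // f Df.
  exact: le_trans (ler_norm _) (bN e f Df).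
by apply: (supD_le Df0) => f Df; exact: le_trans (ler_norm _) (bN e f Df).
Qed.

(** * Rademacher sums of symmetric tensors *)

(** The Lipschitz constant of t^k on [-X, X]. With X = |x_j| it explains the weight k |x_j|^(k-1) of
    the comparison family. *)
Lemma ler_dist_exp (R : realType) (k : nat) (s t X : R) : `|s| <= X -> `|t| <= X ->
  `|s ^+ k - t ^+ k| <= k%:R * X ^+ k.-1 * `|s - t|.
Proof.
move=> sX tX; rewrite subrXX normrM mulrC ler_wpM2r//.
apply: (le_trans (ler_norm_sum _ _ _)).
rewrite -[k in k%:R]card_ord -sum1_card natr_sum mulr_suml; apply: ler_sum => i _.
have X0 : 0 <= X by exact: le_trans sX.
have ik : (i <= k.-1)%N by rewrite -ltnS (ltn_predK (ltn_ord i)).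
rewrite mul1r normrM !normrX -[in leRHS](subnK ik) exprD.
by apply: ler_pM; rewrite ?exprn_ge0// lerXn2r ?nnegrE.
Qed.

(** The q-th power of a bound on the L_q norm of Rademacher sums, multiplied by the number of sign
    vectors to avoid a probability space. K will be the product of the Kahane-Khintchine and type
    constants, or M as a crude fallback. *)
Definition rademacher_bound (R : realType) (E : normedModType R) (p q : R) (M : nat) (K : R) :=
  forall x : 'I_M -> E,
  \sum_(e : {ffun 'I_M -> bool}) `|\sum_j (-1) ^+ e j *: x j| `^ q <=
  2 ^+ M * (K * (\sum_j `|x j| `^ p) `^ p^-1) `^ q.

Section SymTensor.
Context (R : realType) (E : normedModType R) (k : nat).
Local Notation N := (@sym_inj_norm R k E).
Local Notation diag := (@diagonal_tensor R k E).

Lemma sym_tensor_sumE (I : Type) (r : seq I) (U : I -> sym_tensor_power k E) phi :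
  (\sum_(i <- r) U i : sym_tensor_power k E) phi = \sum_(i <- r) U i phi.
Proof. by elim: r => [|i r IH]; rewrite ?big_nil ?big_cons// -IH. Qed.

Lemma sym_tensorZE a (U : sym_tensor_power k E) phi : (a *: U) phi = a * U phi.
Proof. by []. Qed.

Lemma diagonal_tensor_prod_form x (f : {scalar E}) :
  diag x (prod_form (fun=> f)) = f x ^+ k.
Proof. by rewrite /= prodr_const card_ord. Qed.

Lemma sym_inj_norm_rademacher (p q K : R) (M : nat) (x : 'I_M -> E) :
  (0 < k)%N -> 0 < p -> 1 <= q -> 0 <= K -> rademacher_bound E p q M K ->
  \sum_(e : {ffun 'I_M -> bool}) N (\sum_j (-1) ^+ e j *: diag (x j)) `^ q <=
  2 * (2 ^+ M * (k%:R * K * (\sum_j (`|x j| ^+ k) `^ p) `^ p^-1) `^ q).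
Proof.
move=> k0 p0 q1 K0 hK.
have q0 : 0 <= q by exact: le_trans q1.
(* These vectors turn the comparison family into [f (y j)], so its signed sums are f applied to one
   Rademacher sum in E. The norm of [y j] is k |x_j|^k, which explains the k-th powers on the
   right. *)
pose y j := (k%:R * `|x j| ^+ k.-1) *: x j.
have yE j : `|y j| = k%:R * `|x j| ^+ k.
  rewrite normrZ normrM normr_nat normrX normr_id -mulrA -exprSr prednK//.
apply: le_trans (_ : 2 * \sum_(e : {ffun 'I_M -> bool})
    `|\sum_j (-1) ^+ e j *: y j| `^ q <= _); last first.
  apply: ler_wpM2l; first by [].
  apply: le_trans (hK y) _; clear hK.
  apply: ler_wpM2l; first exact: exprn_ge0.
  apply: ge0_ler_powR; first by [].
  - by rewrite nnegrE mulr_ge0 ?powR_ge0.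
  - by rewrite nnegrE mulr_ge0 ?powR_ge0// mulr_ge0.
  rewrite [k%:R * K]mulrC -mulrA ler_wpM2l//.
  under eq_bigr do rewrite -/(y _) yE powRM ?exprn_ge0//.
  have S0 : 0 <= \sum_j (`|x j| ^+ k) `^ p by apply: sumr_ge0 => j _; exact: powR_ge0.
  rewrite -mulr_sumr powRM ?powR_ge0//.
  by rewrite -powRrM divff ?gt_eqF// powRr1.
have fy (f : {scalar E}) j : f (y j) = k%:R * `|x j| ^+ k.-1 * f (x j) by rewrite linearZ.
have fle (f : {scalar E}) z : dual_ball f -> `|f z| <= `|z| by exact: dual_ball_le.
apply: (@contraction_abs_sup R {scalar E} (@dual_ball R E) \0 M q
   (fun j f => f (y j)) (fun j f => f (x j) ^+ k) (fun j => `|y j|)) => //.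
- exact: dual_ball0.
- by move=> i; rewrite /= expr0n gtn_eqF.
- by move=> i f Df; exact: fle.
- move=> i f Df; rewrite fy normrX !normrM normr_nat normrX normr_id -mulrA.
  rewrite -[X in `|f _| ^+ X](prednK k0) exprSr mulrA ler_wpM2r//.
  rewrite -[leLHS]mul1r ler_pM ?exprn_ge0// ?ler1n// lerXn2r ?nnegrE//; exact: fle.
- move=> i f g Df Dg; rewrite !fy -mulrBr normrM normrM normr_nat normrX normr_id.
  by apply: ler_dist_exp; exact: fle.
- by move=> e; exact: (seminorm_ge0 (sym_inj_seminorm k E)).
- move=> e C hC; apply: sym_inj_norm_le => f Df; rewrite sym_tensor_sumE.
  under eq_bigr do rewrite sym_tensorZE diagonal_tensor_prod_form.
  exact: hC.
- move=> e f Df; apply: le_trans (fle f _ Df); rewrite linear_sum.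
  by under [in leRHS]eq_bigr do rewrite linearZ.
Qed.

End SymTensor.

(** * Symmetrization for finite laws *)

Section ProductLaw.
Context (R : realType) (M : nat) (I : finType) (p : I -> R).
Hypotheses (p_ge0 : forall a, 0 <= p a) (p_sum : \sum_a p a = 1).
Implicit Types i : {ffun 'I_M -> I}.

Definition product_law i : R := \prod_j p (i j).
Local Notation w := product_law.

Lemma product_law_ge0 i : 0 <= w i.
Proof. exact: prodr_ge0. Qed.

Lemma product_law_sum : \sum_i w i = 1.
Proof.
by rewrite -(bigA_distr_bigA (fun (_ : 'I_M) a => p a))/= big1.
Qed.

(** The values are vectors so that the lemma serves both the tensors, whose mean is the moment, and
    the scalars in the final bound. *)
Lemma product_law_marginal (V : lmodType R) (g : I -> V) j :
  \sum_i w i *: g (i j) = \sum_a p a *: g a.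
Proof.
rewrite (partition_big (fun i => i j) xpredT)//=; apply: eq_bigr => a _.
rewrite (eq_bigr (fun i => w i *: g a)); last by move=> i /eqP ->.
rewrite -scaler_suml; congr (_ *: _).
(* The indicator of i j = a is built into the j-th factor, so that the sum over i factors by
   distributivity. *)
pose h l b : R := if (l == j) ==> (b == a) then p b else 0.
transitivity (\sum_(i : {ffun 'I_M -> I}) \prod_l h l (i l)).
  rewrite big_mkcond/=; apply: eq_bigr => i _; rewrite /h.
  case: eqP => [ija|/eqP ija].
    apply: eq_bigr => l _; case: eqP => //= ->.
    by rewrite ija eqxx.
  by rewrite (bigD1 j)//= eqxx/= (negPf ija) mul0r.
rewrite -(bigA_distr_bigA h) (bigD1 j)//= /h eqxx.
rewrite (bigD1 a)//= eqxx big1 ?addr0; last by move=> b /negPf ->.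
by rewrite big1 ?mulr1// => l /negPf ->.
Qed.

Context (X : lmodType R) (N : seminorm X).

Lemma seminorm_sum (J : Type) (r : seq J) (F : J -> X) :
  N (\sum_(j <- r) F j) <= \sum_(j <- r) N (F j).
Proof.
elim: r => [|j r IH]; first by rewrite !big_nil seminorm0.
by rewrite !big_cons (le_trans (seminormD _ _ _))// lerD2l.
Qed.

Lemma seminorm_jensen (J : finType) (c : J -> R) (u : J -> X) q : 1 <= q ->
  (forall j, 0 <= c j) -> \sum_j c j = 1 ->
  N (\sum_j c j *: u j) `^ q <= \sum_j c j * N (u j) `^ q.
Proof.
move=> q1 c0 c1; apply: le_trans (powR_jensen q1 c0 c1 (fun j => seminorm_ge0 N _)).
rewrite ge0_ler_powR ?nnegrE ?seminorm_ge0//; first exact: le_trans q1.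
  by apply: sumr_ge0 => j _; rewrite mulr_ge0 ?seminorm_ge0.
apply: (le_trans (seminorm_sum _ _)); apply: ler_sum => j _.
by rewrite seminormZ ger0_norm.
Qed.

Context (v : I -> X).
Let m := \sum_a p a *: v a.

(** The bound holds for every single sign vector. The copy enters through Jensen, M m being the mean
    of [Z] over the copy. Splitting the signed difference costs 2^(q-1) for each of two copies with
    the same law, together 2^q. *)
Lemma symmetrization_signs (e : {ffun 'I_M -> bool}) q : 1 <= q ->
  \sum_i w i * N (\sum_j v (i j) - M%:R *: m) `^ q <=
  2 `^ q * \sum_i w i * N (\sum_j (-1) ^+ e j *: v (i j)) `^ q.
Proof.
move=> q1; pose Z i := \sum_j v (i j); pose S i := \sum_j (-1) ^+ e j *: v (i j).
have mean : \sum_i w i *: Z i = M%:R *: m.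
  under eq_bigr do rewrite scaler_sumr.
  rewrite exchange_big/=; under eq_bigr do rewrite product_law_marginal.
  by rewrite sumr_const card_ord -scaler_nat.
apply: le_trans (_ : \sum_i \sum_i' w i * w i' * N (Z i - Z i') `^ q <= _).
  apply: ler_sum => i _; under [leRHS]eq_bigr do rewrite -mulrA.
  rewrite -mulr_sumr ler_wpM2l ?product_law_ge0//.
  have -> : \sum_j v (i j) - M%:R *: m = \sum_i' w i' *: (Z i - Z i').
    under [RHS]eq_bigr do rewrite scalerBr.
    by rewrite sumrB -scaler_suml product_law_sum scale1r mean.
  exact: seminorm_jensen q1 product_law_ge0 product_law_sum.
pose T : finType := ({ffun 'I_M -> I} * {ffun 'I_M -> I})%type.
(* exchanging the two copies in the coordinates where the sign is -1 *)
pose sw (z : T) : T := ([ffun j => if e j then z.2 j else z.1 j],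
                        [ffun j => if e j then z.1 j else z.2 j]).
have swK : involutive sw.
  by case=> i i'; congr pair; apply/ffunP => j; rewrite !ffunE/= ?ffunE; case: (e j).
rewrite pair_bigA/= (reindex_inj (inv_inj swK))/=.
have -> : \sum_(z : T) w (sw z).1 * w (sw z).2 * N (Z (sw z).1 - Z (sw z).2) `^ q =
    \sum_(z : T) w z.1 * w z.2 * N (S z.1 - S z.2) `^ q.
  apply: eq_bigr => -[i i'] _; congr (_ * N _ `^ q).
    rewrite /w -!big_split/=; apply: eq_bigr => j _; rewrite !ffunE/=.
    by case: ifP => // _; rewrite mulrC.
  rewrite /Z /S -!sumrB; apply: eq_bigr => j _; rewrite !ffunE/= -scalerBr.
  by case: (e j); rewrite ?scale1r// scaleN1r opprB.
have q0 : 0 <= q by exact: le_trans q1.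
rewrite -(pair_bigA _ (fun i i' => w i * w i' * N (S i - S i') `^ q))/=.
apply: le_trans (_ : \sum_i \sum_i' w i * w i' *
    (2 `^ (q - 1) * (N (S i) `^ q + N (S i') `^ q)) <= _).
  apply: ler_sum => i _; apply: ler_sum => i' _.
  rewrite ler_wpM2l ?mulr_ge0 ?product_law_ge0//.
  apply: le_trans (powR_add_le q1 (seminorm_ge0 N _) (seminorm_ge0 N _)).
  rewrite ge0_ler_powR ?nnegrE ?addr_ge0 ?seminorm_ge0//.
  by rewrite (le_trans (seminormD _ _ _))// seminormN.
have -> : \sum_i \sum_i' w i * w i' *
    (2 `^ (q - 1) * (N (S i) `^ q + N (S i') `^ q)) =
    2 `^ (q - 1) * (\sum_i \sum_i' w i' * (w i * N (S i) `^ q) +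
                    \sum_i \sum_i' w i * (w i' * N (S i') `^ q)).
  rewrite -big_split mulr_sumr; apply: eq_bigr => i _ /=.
  by rewrite -big_split mulr_sumr; apply: eq_bigr => i' _ /=; ring.
have one (g : {ffun 'I_M -> I} -> R) : \sum_i \sum_i' w i' * g i = \sum_i g i.
  by apply: eq_bigr => i _; rewrite -mulr_suml product_law_sum mul1r.
rewrite [X in _ * (_ + X)]exchange_big/= !one.
rewrite -[in leRHS](@mulr_powRB1 _ 2 q) ?(lt_le_trans _ q1)//.
by apply: eq_ler; ring.
Qed.

Lemma symmetrization q : 1 <= q ->
  2 ^+ M * \sum_i w i * N (\sum_j v (i j) - M%:R *: m) `^ q <=
  2 `^ q * \sum_i w i * \sum_(e : {ffun 'I_M -> bool})
    N (\sum_j (-1) ^+ e j *: v (i j)) `^ q.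
Proof.
move=> q1; have -> : 2 ^+ M = \sum_(e : {ffun 'I_M -> bool}) (1 : R).
  by rewrite sumr_const card_ffun card_bool card_ord natrX.
under [X in _ <= _ * X]eq_bigr do rewrite mulr_sumr.
rewrite mulr_suml [in leRHS]exchange_big [leRHS]mulr_sumr; apply: ler_sum => e _.
by rewrite mul1r symmetrization_signs.
Qed.

End ProductLaw.

(** * The rate for finite laws *)

Section FiniteLaw.
Context (R : realType) (E : normedModType R) (k M : nat) (I : finType).
Context (p q K : R) (l : I -> R) (y : I -> E).
Hypotheses (k_gt0 : (0 < k)%N) (M_gt0 : (0 < M)%N) (p_ge1 : 1 <= p) (pq : p <= q).
Hypotheses (K_ge0 : 0 <= K) (hK : rademacher_bound E p q M K).
Hypotheses (l_ge0 : forall a, 0 <= l a) (l_sum : \sum_a l a = 1).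
Local Notation N := (@sym_inj_norm R k E).
Local Notation diag := (@diagonal_tensor R k E).

(** Jensen with exponent q/p for the uniform weights 1/M. After the q-th root the factor is M^(1/p);
    divided by the M of the sample average it gives the rate M^(-(1 - 1/p)). *)
Lemma power_mean (a : 'I_M -> R) : (forall j, 0 <= a j) ->
  ((\sum_j a j `^ p) `^ p^-1) `^ q <= M%:R `^ (q / p) * \sum_j M%:R^-1 * a j `^ q.
Proof.
move=> a0; have p0 : 0 < p by exact: lt_le_trans p_ge1.
have M0 : 0 < M%:R :> R by rewrite ltr0n.
have -> : \sum_j a j `^ p = M%:R * \sum_j M%:R^-1 * a j `^ p.
  by rewrite -mulr_sumr mulrA divff ?gt_eqF// mul1r.
rewrite -powRrM [p^-1 * q]mulrC powRM ?(ltW M0)//; last first.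
  by apply: sumr_ge0 => j _; rewrite mulr_ge0 ?powR_ge0// invr_ge0 ltW.
rewrite ler_wpM2l ?powR_ge0//.
apply: le_trans (powR_jensen _ _ _ _) _.
- by rewrite ler_pdivlMr// mul1r.
- by move=> j; rewrite invr_ge0 ltW.
- by rewrite sumr_const card_ord -(mulr_natl M%:R^-1) divff// gt_eqF.
- by move=> j; rewrite powR_ge0.
apply: ler_sum => j _; rewrite -powRrM mulrCA divff ?gt_eqF// mulr1//.
Qed.

(** The factors 2^q from symmetrization and 2 from the comparison are merged by 2 <= 2^q into 4^q,
    which makes the constant independent of q. *)
Lemma monte_carlo_finite_law :
  \sum_(i : {ffun 'I_M -> I}) product_law l i *
    N (\sum_a l a *: diag (y a) - M%:R^-1 *: \sum_j diag (y (i j))) `^ q <=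
  (4 * k%:R * K * M%:R `^ (- (1 - p^-1))) `^ q * \sum_a l a * (`|y a| ^+ k) `^ q.
Proof.
have p0 : 0 < p by exact: lt_le_trans p_ge1.
have q1 : 1 <= q by exact: le_trans pq.
have q0 : 0 < q by exact: lt_le_trans q1.
have M0 : 0 < M%:R :> R by rewrite ltr0n.
have Mn0 : M%:R != 0 :> R by rewrite gt_eqF.
have Mi0 : 0 <= M%:R^-1 :> R by rewrite invr_ge0 ltW.
have w0 := product_law_ge0 l_ge0.
pose NX := sym_inj_seminorm k E; pose m := \sum_a l a *: diag (y a).
have -> : \sum_(i : {ffun 'I_M -> I}) product_law l i *
    N (m - M%:R^-1 *: \sum_j diag (y (i j))) `^ q =
    (M%:R^-1) `^ q * \sum_(i : {ffun 'I_M -> I}) product_law l i *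
    NX (\sum_j diag (y (i j)) - M%:R *: m) `^ q.
  rewrite mulr_sumr; apply: eq_bigr => i _; rewrite mulrCA; congr (_ * _).
  rewrite -powRM ?seminorm_ge0//; congr (_ `^ _).
  rewrite -[M%:R^-1 in RHS]ger0_norm// -seminormZ scalerBr scalerA mulVf// scale1r.
  exact: (seminorm_distC NX).
have P0 : 0 < 2 ^+ M :> R by rewrite exprn_gt0.
have := symmetrization M l_ge0 l_sum NX (fun a => diag (y a)) q1.
rewrite -/m -ler_pdivlMl// => /(ler_wpM2l (powR_ge0 M%:R^-1 q)) /le_trans; apply.
pose g j := (`|y j| ^+ k) `^ q.
apply: le_trans (_ : M%:R^-1 `^ q * ((2 ^+ M)^-1 * (2 `^ q *
   \sum_(i : {ffun 'I_M -> I}) product_law l i *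
   (2 * (2 ^+ M * ((k%:R * K) `^ q * (M%:R `^ (q / p) * \sum_j M%:R^-1 * g (i j)))))))
    <= _).
  rewrite ler_wpM2l ?powR_ge0// ler_wpM2l ?invr_ge0 ?(ltW P0)// ler_wpM2l ?powR_ge0//.
  apply: ler_sum => i _; rewrite ler_wpM2l//.
  apply: le_trans (sym_inj_norm_rademacher (fun j => y (i j)) k_gt0 p0 q1 K_ge0 hK) _.
  apply: ler_wpM2l; first by [].
  apply: ler_wpM2l; first exact: ltW.
  rewrite powRM ?powR_ge0 ?mulr_ge0//.
  apply: ler_wpM2l; first exact: powR_ge0.
  by apply: (@power_mean (fun j => `|y (i j)| ^+ k)) => j; rewrite exprn_ge0.
have -> : \sum_(i : {ffun 'I_M -> I}) product_law l i *
   (2 * (2 ^+ M * ((k%:R * K) `^ q * (M%:R `^ (q / p) * \sum_j M%:R^-1 * g (i j))))) =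
   2 * 2 ^+ M * ((k%:R * K) `^ q * M%:R `^ (q / p)) * \sum_a l a * g a.
  have mean j : \sum_(i : {ffun 'I_M -> I}) product_law l i * (M%:R^-1 * g (i j)) =
      \sum_a l a * (M%:R^-1 * g a).
    exact: (product_law_marginal l_sum (fun a => M%:R^-1 * g a : R^o) j).
  transitivity (2 * 2 ^+ M * ((k%:R * K) `^ q * M%:R `^ (q / p)) *
      \sum_(i : {ffun 'I_M -> I}) product_law l i * \sum_j M%:R^-1 * g (i j)).
    by rewrite mulr_sumr; apply: eq_bigr => i _; ring.
  congr (_ * _); under eq_bigr do rewrite mulr_sumr.
  rewrite exchange_big/=; under eq_bigr do rewrite mean.
  rewrite sumr_const card_ord -sumrMnl; apply: eq_bigr => a _.
  by rewrite -(mulr_natl (_ * _)); field.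
have Mpow : M%:R^-1 `^ q * M%:R `^ (q / p) = (M%:R `^ (- (1 - p^-1))) `^ q :> R.
  rewrite -powR_inv1 ?(ltW M0)// -!powRrM -powRD ?Mn0 ?implybT//.
  by congr (_ `^ _); field; rewrite gt_eqF.
rewrite [leRHS](_ : _ = (2 `^ q * 2 `^ q * (k%:R * K) `^ q * (M%:R `^ (- (1 - p^-1))) `^ q) *
    \sum_a l a * g a); last first.
  congr (_ * _); rewrite -!powRM ?mulr_ge0 ?powR_ge0//; congr (_ `^ _).
  by ring.
rewrite -Mpow.
have S0 : 0 <= \sum_a l a * g a.
  by apply: sumr_ge0 => a _; rewrite mulr_ge0// powR_ge0.
rewrite [leLHS](_ : _ = (2 * 2 `^ q * (k%:R * K) `^ q * (M%:R^-1 `^ q * M%:R `^ (q / p))) *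
    \sum_a l a * g a); last by field; rewrite gt_eqF.
apply: ler_wpM2r; first by [].
do 3 (apply: ler_wpM2r; first by rewrite ?mulr_ge0 ?powR_ge0).
by rewrite le1r_powR// ler1n.
Qed.

End FiniteLaw.

(** * Bochner measurability and the Bochner integral *)

Section SimpleFunctions.
Context (R : realType) (d : measure_display) (Omega : measurableType d).
Context (P : probability Omega R).

Lemma simple_rv_preimage (F : normedModType R) (s : Omega -> F) (A : set F) :
  simple_rv s -> measurable (s @^-1` A).
Proof.
move=> [fs ms].
have -> : s @^-1` A = \bigcup_(y in range s `&` A) s @^-1` [set y].
  apply/seteqP; split => [w Aw|w [y [_ Ay] /= ->]//].
  by exists (s w) => //; split => //; exists w.
by apply: fin_bigcup_measurable => //; exact: finite_setIl.
Qed.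

Lemma simple_rv_cst (F : normedModType R) (a : F) : simple_rv (fun _ : Omega => a).
Proof.
split=> [|y]; last by rewrite preimage_cst; case: ifP.
apply: (@sub_finite_set _ _ [set a]); last exact: finite_set1.
by move=> _ [w _ <-].
Qed.

Lemma simple_rv_comp (F G : normedModType R) (h : F -> G) (s : Omega -> F) :
  simple_rv s -> simple_rv (h \o s).
Proof.
move=> hs; split=> [|y].
  have [fs _] := hs.
  have -> : range (h \o s) = h @` range s by rewrite image_comp.
  exact: finite_image.
by rewrite comp_preimage; exact: simple_rv_preimage.
Qed.

Lemma bochner_measurable_comp (F G : normedModType R) (h : F -> G) (X : Omega -> F) :
  continuous h -> bochner_measurable P X -> bochner_measurable P (h \o X).
Proof.
move=> hc [s [ss sX]]; exists (fun n => h \o s n); split.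
  by move=> n; exact: simple_rv_comp.
apply: filterS sX => w sw; exact: (continuous_cvg _ (hc _) sw).
Qed.

Lemma simple_rv_bochner (F : normedModType R) (s : Omega -> F) :
  simple_rv s -> bochner_measurable P s.
Proof. by move=> ss; exists (fun=> s); split => //; apply: aeW => w; exact: cvg_cst. Qed.

Lemma coded_measurable (I : finType) (Z : Omega -> I) (A : set I) :
  (forall i, measurable (Z @^-1` [set i])) -> measurable (Z @^-1` A).
Proof.
move=> mZ; have -> : Z @^-1` A = \bigcup_(i in A) Z @^-1` [set i].
  by apply/seteqP; split => [w Aw|w [i Ai /= ->]//]; exists (Z w).
exact: fin_bigcup_measurable.
Qed.

Lemma coded_measurable_fun (I : finType) d' (T : measurableType d') (Z : Omega -> I)
    (g : I -> T) : (forall i, measurable (Z @^-1` [set i])) ->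
  measurable_fun setT (fun w => g (Z w)).
Proof.
move=> mZ _ B mB; rewrite setTI -[X in measurable X]/(Z @^-1` (g @^-1` B)).
exact: coded_measurable.
Qed.

Lemma coded_simple_rv (I : finType) (F : normedModType R) (Z : Omega -> I) (v : I -> F) :
  (forall i, measurable (Z @^-1` [set i])) -> simple_rv (fun w => v (Z w)).
Proof.
move=> mZ; split=> [|y].
  apply: (@sub_finite_set _ _ (range v)); last exact: finite_image.
  by move=> _ [w _ <-]; exists (Z w).
by rewrite -[X in measurable X]/(Z @^-1` (v @^-1` [set y])); exact: coded_measurable.
Qed.

(** Finitely many simple functions are functions of one variable Z with values in a finite type, so
    joint expectations become finite sums. The code is the tuple of indices in a common list of
    values. *)
Lemma simple_rv_code (J : finType) (F : normedModType R) (s : J -> Omega -> F) :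
  (forall j, simple_rv (s j)) ->
  exists (I : finType) (Z : Omega -> I) (v : I -> J -> F),
    (forall i, measurable (Z @^-1` [set i])) /\ forall w j, s j w = v (Z w) j.
Proof.
move=> ss.
have /choice[l hl] : forall j, exists l : seq F, forall w, s j w \in l.
  move=> j; have [/finite_seqP[l ls] _] := ss j; exists l => w.
  have : range (s j) (s j w) by exists w.
  by rewrite ls.
pose L := flatten [seq l j | j <- enum J].
have sL w j : s j w \in L.
  by apply/flatten_mapP; exists j; rewrite ?mem_enum// hl.
(* The extra index receives the vectors outside [L]; by [sL] no value of the family is among
   them. *)
pose code (y : F) : 'I_(size L).+1 := inord (index y L).
exists {ffun J -> 'I_(size L).+1}, (fun w => [ffun j => code (s j w)]),
  (fun (i : {ffun J -> 'I_(size L).+1}) j => nth 0 L (i j)); split.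
  move=> i.
  rewrite (_ : _ @^-1` _ = \bigcap_(j in [set: J]) (s j @^-1` [set y | code y = i j])).
    apply: fin_bigcap_measurable => // j _; exact: simple_rv_preimage.
  apply/seteqP; split=> [w /= <- j _ /=|w /= wi]; first by rewrite ffunE.
  by apply/ffunP => j; rewrite ffunE; exact: wi.
move=> w j; rewrite ffunE /code inordK ?nth_index//.
by rewrite ltnS index_size.
Qed.

Lemma simple_rv_family_measurable (J : finType) (F : normedModType R)
    (s : J -> Omega -> F) d' (T : measurableType d') (phi : (J -> F) -> T) :
  (forall j, simple_rv (s j)) ->
  measurable_fun setT (fun w => phi (fun j => s j w)).
Proof.
move=> /simple_rv_code[I [Z [v [mZ sv]]]].
have -> : (fun w => phi (fun j => s j w)) = (fun w => phi (v (Z w))).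
  by apply/funext => w; congr phi; apply/funext => j.
exact: (coded_measurable_fun (fun i => phi (v i))).
Qed.

Hypothesis cP : measure_is_complete P.

(** Multiplying by the indicator of the complement of a null set gives a limit everywhere, hence a
    measurable one. It agrees with f almost everywhere, and completeness transfers measurability to
    f. *)
Lemma ae_cvg_measurable (f_ : nat -> Omega -> R) (f : Omega -> R) :
  (forall n, measurable_fun setT (f_ n)) ->
  {ae P, forall w, f_ n w @[n --> \oo] --> f w} -> measurable_fun setT f.
Proof.
move=> mf [N [mN N0 subN]].
pose h n := fun w => f_ n w * \1_(~` N) w.
have mh n : measurable_fun setT (h n).
  by apply: measurable_realfun.measurable_funM => //; apply: measurable_indic; exact: measurableC.
have mg : measurable_fun setT (fun w => f w * \1_(~` N) w).
  apply: measurable_fun_cvg mh _ => w _; rewrite /h.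
  have [wN|wN] := pselect (N w).
    have -> : (\1_(~` N) w : R) = 0 by rewrite indicE memNset.
    rewrite mulr0; have -> : (fun n => f_ n w * 0) = cst 0 by apply/funext => n; rewrite mulr0.
    exact: cvg_cst.
  apply: cvgMl; have := subN w; move/contra_not => /(_ wN); exact: contrapT.
apply/measurable_EFinP; have /measurable_EFinP := mg; apply: (ae_measurable_fun cP).
exists N; split => // w /= wf; apply: contrapT => Nw; apply: wf => _ /=.
by rewrite indicE mem_set// mulr1.
Qed.

(* The hypothesis is sequential continuity of [phi] for pointwise convergence. *)
Lemma bochner_measurable_family (J : finType) (F : normedModType R)
    (X : J -> Omega -> F) (phi : (J -> F) -> R) :
  (forall j, bochner_measurable P (X j)) ->
  (forall (u : nat -> J -> F) (a : J -> F),
    (forall j, u n j @[n --> \oo] --> a j) -> phi (u n) @[n --> \oo] --> phi a) ->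
  measurable_fun setT (fun w => phi (fun j => X j w)).
Proof.
move=> /choice[s hs] phic.
apply: (@ae_cvg_measurable (fun n w => phi (fun j => s j n w))) => [n|].
  by apply: simple_rv_family_measurable => j; have [] := hs j.
have : {ae P, forall w j, s j n w @[n --> \oo] --> X j w}.
  by apply: filter_forall => j; have [] := hs j.
by apply: filterS => w sw; exact: phic.
Qed.

Lemma bochner_measurable_real (F : normedModType R) (X : Omega -> F) (phi : F -> R) :
  bochner_measurable P X -> continuous phi -> measurable_fun setT (phi \o X).
Proof.
move=> bX phic.
apply: (@bochner_measurable_family unit F (fun=> X) (fun x => phi (x tt))) => // u a ua.
exact: (continuous_cvg _ (phic _) (ua tt)).
Qed.

Lemma bochner_measurable_real2 (F : normedModType R) (X Y : Omega -> F) (phi : F -> F -> R) :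
  bochner_measurable P X -> bochner_measurable P Y ->
  (forall (u v : nat -> F) a b, u n @[n --> \oo] --> a -> v n @[n --> \oo] --> b ->
    phi (u n) (v n) @[n --> \oo] --> phi a b) ->
  measurable_fun setT (fun w => phi (X w) (Y w)).
Proof.
move=> bX bY phic.
apply: (@bochner_measurable_family bool F (fun b => if b then X else Y)
  (fun x => phi (x true) (x false))) => [[]//|u a ua].
exact: phic (ua true) (ua false).
Qed.

End SimpleFunctions.

(** * Expectations of functions of a finite code *)

Section Expectations.
Context (R : realType) (d : measure_display) (Omega : measurableType d).
Context (P : probability Omega R).

Section Coded.
Context (I : finType) (Z : Omega -> I).
Hypothesis mZ : forall i, measurable (Z @^-1` [set i]).

Definition law (i : I) : R := fine (P (Z @^-1` [set i])).

Lemma lawE i : (law i)%:E = P (Z @^-1` [set i]).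
Proof. by rewrite fineK// fin_num_measure. Qed.

Lemma law_ge0 i : 0 <= law i.
Proof. by rewrite fine_ge0. Qed.

Lemma coded_integral (g : I -> R) : (forall i, 0 <= g i) ->
  (\int[P]_w (g (Z w))%:E)%E = (\sum_i law i * g i)%:E.
Proof.
move=> g0.
have -> : (fun w => (g (Z w))%:E) =
    (fun w => (\sum_i (g i)%:E * (\1_(Z @^-1` [set i]) w)%:E)%E).
  apply/funext => w; rewrite (bigD1 (Z w))//= big1.
    by rewrite adde0 indicE mem_set// mule1.
  by move=> i iw; rewrite indicE memNset ?mule0//= => iz; rewrite iz eqxx in iw.
rewrite ge0_integral_sum//.
- rewrite -sumEFin; apply: eq_bigr => i _.
  rewrite ge0_integralZl_EFin//.
  + by rewrite integral_indic// setIT EFinM lawE muleC.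
  + by apply/measurable_EFinP; exact: measurable_indic.
- move=> i; apply: measurable_funeM; apply/measurable_EFinP; exact: measurable_indic.
- by move=> i w _; rewrite mule_ge0// lee_fin.
Qed.

Lemma law_sum : \sum_i law i = 1.
Proof.
apply: EFin_inj; transitivity (\int[P]_w 1)%E.
  rewrite (@coded_integral (fun=> 1))//; congr (_%:E).
  by apply: eq_bigr => i _; rewrite mulr1.
by rewrite integral_cst// mul1e; exact: probability_setT.
Qed.

Lemma coded_expectation (F : normedModType R) (v : I -> F) :
  simple_expectation P (fun w => v (Z w)) = \sum_i law i *: v i.
Proof.
rewrite /simple_expectation.
have preE y : fine (P ((fun w => v (Z w)) @^-1` [set y])) = \sum_(i | v i == y) law i.
  apply: EFin_inj; rewrite fineK; last first.
    rewrite fin_num_measure//; exact: (@coded_measurable _ _ _ Z (v @^-1` [set y])).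
  have := @coded_integral (fun i => (v i == y)%:R) (fun=> ler0n _ _).
  rewrite (_ : (fun w => _) = (fun w => (\1_((fun w => v (Z w)) @^-1` [set y]) w)%:E)).
    rewrite integral_indic//; last exact: (@coded_measurable _ _ _ Z (v @^-1` [set y])).
    rewrite setIT => ->; congr (_%:E); rewrite [RHS]big_mkcond/=.
    by apply: eq_bigr => i _; case: eqP; rewrite ?mulr1 ?mulr0.
  apply/funext => w; rewrite indicE; case: eqP => [h|h].
    by rewrite mem_set.
  by rewrite memNset.
have fin : finite_set (range (fun w => v (Z w))).
  by have [] := coded_simple_rv v mZ.
(* Some values of [v] may not be attained by v o Z; their preimages are empty and contribute
   nothing. *)
pose r := undup (codom v).
rewrite (fsbig_widen _ [set` r]); last 2 first.
- by move=> _ [w _ <-] /=; rewrite mem_undup codom_f.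
- move=> y [_ /= yr]; rewrite preimage10// ?measure0 ?fine0 ?scale0r//.
rewrite -fsbig_seq ?undup_uniq//.
transitivity (\sum_(y <- r) \sum_(i | v i == y) law i *: v i).
  apply: eq_bigr => y _; rewrite preE scaler_suml.
  by apply: eq_bigr => i /eqP ->.
under eq_bigr do rewrite big_mkcond.
rewrite exchange_big/=; apply: eq_bigr => i _.
rewrite -big_mkcond/= (eq_bigl (fun y => y == v i)); last by move=> y; rewrite eq_sym.
by rewrite (big_rem (v i)) ?mem_undup ?codom_f//= eqxx big1_seq ?addr0// => y /andP[/eqP ->];
  rewrite mem_rem_uniqF ?undup_uniq.
Qed.
End Coded.
End Expectations.

Section BochnerIntegral.
Context (R : realType) (d : measure_display) (Omega : measurableType d).
Context (P : probability Omega R).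

Lemma cvg_EFinW (x_ : nat -> R) (x : R) : x_ n @[n --> \oo] --> x ->
  (x_ n)%:E @[n --> \oo] --> x%:E.
Proof. by move=> xx; apply: cvg_EFin => //; exact: nearW. Qed.

Lemma cvge_le_cvg (x_ y_ : nat -> \bar R) (x y : \bar R) :
  x_ n @[n --> \oo] --> x -> y_ n @[n --> \oo] --> y ->
  (forall n, (x_ n <= y_ n)%E) -> (x <= y)%E.
Proof.
by move=> xx yy xy; apply: (lee_cvg_to xx yy); exact: nearW.
Qed.

Lemma integral_triangle (f g h : Omega -> R) :
  measurable_fun setT f -> measurable_fun setT g -> measurable_fun setT h ->
  (forall w, 0 <= f w) -> (forall w, 0 <= g w) -> (forall w, 0 <= h w) ->
  (forall w, f w <= g w + h w) ->
  (\int[P]_w (f w)%:E <= \int[P]_w (g w)%:E + \int[P]_w (h w)%:E)%E.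
Proof.
move=> mf mg mh f0 g0 h0 fgh; rewrite -ge0_integralD//.
- apply: ge0_le_integral => //; last by move=> w _; rewrite -EFinD lee_fin.
  + by move=> w _; rewrite lee_fin.
  + exact/measurable_EFinP.
  + by apply: emeasurable_funD; exact/measurable_EFinP.
- by move=> w _; rewrite lee_fin.
- exact/measurable_EFinP.
- by move=> w _; rewrite lee_fin.
- exact/measurable_EFinP.
Qed.

(** With a common code for s and t this is the triangle inequality for a finite sum. *)
Lemma simple_expectation_dist (F : normedModType R) (s t : Omega -> F) :
  simple_rv s -> simple_rv t ->
  (`|simple_expectation P s - simple_expectation P t|%:E <= \int[P]_w `|s w - t w|%:E)%E.
Proof.
move=> ss st.
have st' (b : bool) : simple_rv (if b then s else t) by case: b.
have [I [Z [v [mZ sv]]]] := simple_rv_code st'.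
have -> : s = (fun w => v (Z w) true) by apply/funext => w; exact: (sv w true).
have -> : t = (fun w => v (Z w) false) by apply/funext => w; exact: (sv w false).
rewrite (coded_expectation P mZ (fun i => v i true)) (coded_expectation P mZ (fun i => v i false)).
rewrite (coded_integral P mZ (fun i => normr_ge0 (v i true - v i false))) lee_fin.
rewrite -sumrB; apply: (le_trans (ler_norm_sum _ _ _)); apply: ler_sum => i _.
by rewrite -scalerBr normrZ ger0_norm// law_ge0.
Qed.

Hypothesis cP : measure_is_complete P.

Lemma bochner_dist_measurable (F : normedModType R) (f g : Omega -> F) :
  bochner_measurable P f -> bochner_measurable P g ->
  measurable_fun setT (fun w => `|f w - g w|).
Proof.
move=> bf bg; apply: (bochner_measurable_real2 cP (phi := fun x y => `|x - y|)) => //.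
by move=> u v a b ua vb; apply: cvg_norm; exact: cvgB.
Qed.

Lemma bochner_norm_measurable (F : normedModType R) (f : Omega -> F) :
  bochner_measurable P f -> measurable_fun setT (fun w => `|f w|).
Proof. by move=> bf; apply: (bochner_measurable_real cP bf) => x; exact: norm_continuous. Qed.

Lemma bochner_dist_triangle (F : normedModType R) (f g h : Omega -> F) :
  bochner_measurable P f -> bochner_measurable P g -> bochner_measurable P h ->
  (\int[P]_w `|f w - h w|%:E <= \int[P]_w `|f w - g w|%:E + \int[P]_w `|g w - h w|%:E)%E.
Proof.
move=> bf bg bh; apply: integral_triangle => //; try exact: bochner_dist_measurable.
by move=> w; rewrite -[f w - h w](subrKA (g w)) ler_normD.
Qed.

Lemma bochner_distC (F : normedModType R) (f g : Omega -> F) :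
  (\int[P]_w `|f w - g w|%:E = \int[P]_w `|g w - f w|%:E)%E.
Proof. by apply: eq_integral => w _; rewrite distrC. Qed.

Lemma bochner_integral_unique (F : normedModType R) (f : Omega -> F) (v v' : F) :
  is_bochner_integral P f v -> is_bochner_integral P f v' -> v = v'.
Proof.
move=> [bf [s [ss sf sv]]] [_ [t [st tf tv]]]; apply/eqP; rewrite -subr_eq0 -normr_le0.
have cv : `|simple_expectation P (s n) - simple_expectation P (t n)|%:E @[n --> \oo] -->
    `|v - v'|%:E.
  by apply: cvg_EFinW; apply: cvg_norm; exact: cvgB.
have c0 : (\int[P]_w `|f w - s n w|%:E + \int[P]_w `|f w - t n w|%:E)%E @[n --> \oo] -->
    (0 : \bar R)%E.
  by rewrite -[X in _ --> X]adde0; exact: cvgeD.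
rewrite -lee_fin; apply: (cvge_le_cvg cv c0) => n /=.
have bs := simple_rv_bochner P (ss n); have bt := simple_rv_bochner P (st n).
apply: (le_trans (simple_expectation_dist (ss n) (st n))).
by rewrite [X in (_ <= X + _)%E]bochner_distC; exact: bochner_dist_triangle.
Qed.

Lemma bochner_integralE (F : normedModType R) (f : Omega -> F) (v : F) :
  is_bochner_integral P f v -> bochner_integral P f = v.
Proof.
move=> fv; apply: xget_unique => // v' fv'; exact: bochner_integral_unique fv' fv.
Qed.

(** The bounds [c_] may vary with n, since the discretized moments on the right converge but need
    not be bounded by their limit. *)
Lemma fatou_ae (f_ : nat -> Omega -> R) (f : Omega -> R) (c_ : nat -> \bar R) (c : \bar R) :
  (forall n, measurable_fun setT (f_ n)) -> (forall n w, 0 <= f_ n w) ->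
  (forall w, 0 <= f w) -> {ae P, forall w, f_ n w @[n --> \oo] --> f w} ->
  (forall n, (\int[P]_w (f_ n w)%:E <= c_ n)%E) -> c_ n @[n --> \oo] --> c ->
  (\int[P]_w (f w)%:E <= c)%E.
Proof.
move=> mf f0 f0' ff fc cc.
have mlim : measurable_fun setT f by exact: ae_cvg_measurable ff.
have lim0 (u : nat -> \bar R) : (forall n, 0 <= u n)%E -> (0 <= limn_einf u)%E.
  move=> u0; rewrite limn_einf_lim; apply: lime_ge; first exact: is_cvg_einfs.
  by apply: nearW => n; apply: le_ereal_inf_tmp => _ [m _ <-].
apply: le_trans (_ : \int[P]_w limn_einf (fun n => (f_ n w)%:E) <= _)%E.
  apply: ae_ge0_le_integral => //.
  - by move=> w _; rewrite lee_fin.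
  - exact/measurable_EFinP.
  - by move=> w _; apply: lim0 => n; rewrite lee_fin.
  (* Measurability of the lower limit is read off from that of the upper limit of the negatives. *)
  - rewrite (_ : (fun w => _) =
        (fun w => - limn_esup (fun n => - (f_ n w)%:E))%E); last first.
      apply/funext => w; rewrite -[LHS]oppeK; congr (- _)%E.
      by rewrite -limn_esupN.
    apply: measurableT_comp => //; apply: measurable_fun_limn_esup => n.
    by apply: measurableT_comp => //; exact/measurable_EFinP.
  - apply: filterS ff => w fw _.
    by have [-> _] := cvg_limn_einf_sup (cvg_EFinW fw).
apply: (le_trans (fatou _ _ _ _)) => //.
- by move=> n; exact/measurable_EFinP.
- by move=> n w _; rewrite lee_fin.
rewrite -(cvg_limn_einf_sup cc).1 !limn_einf_lim.
apply: lee_lim; [exact: is_cvg_einfs|exact: is_cvg_einfs|apply: nearW => n].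
apply: le_ereal_inf_tmp => _ [m mn <-] /=; apply: le_trans (fc m).
by apply: ereal_inf_lbound; exists m.
Qed.

End BochnerIntegral.

(** * Nearest-point discretization *)

Section Nearest.
Context (R : realType) (E : normedModType R) (y : nat -> E).

Fixpoint nearest (n : nat) (x : E) : nat :=
  if n is m.+1 then
    if `|x - y m.+1| < `|x - y (nearest m x)| then m.+1 else nearest m x
  else 0%N.

Lemma nearest_le n x : (nearest n x <= n)%N.
Proof. by elim: n => //= n IH; case: ifP => // _; exact: leqW. Qed.

Lemma nearest_min n x i : (i <= n)%N -> `|x - y (nearest n x)| <= `|x - y i|.
Proof.
elim: n => [|n IH]; first by rewrite leqn0 => /eqP ->.
rewrite leq_eqVlt ltnS => /predU1P[->|/IH h] /=; first by case: ltP.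
by case: ltP => // /ltW h'; exact: le_trans h.
Qed.

Definition adherent (x : E) : Prop := forall e : R, 0 < e -> exists i, `|x - y i| < e.

Lemma nearest_cvg x : adherent x -> y (nearest n x) @[n --> \oo] --> x.
Proof.
move=> hx; apply/cvgrPdist_lt => e /hx[i xi]; exists i => // n /= ni.
exact: le_lt_trans (nearest_min _ ni) xi.
Qed.

(** The recursion builds each cell from comparisons of distances to the points. Only measurability
    of the distances is assumed of X, so the lemma covers Bochner measurable variables as well as
    the identity of E with its Borel sets. *)
Lemma nearest_measurable d (T : measurableType d) (X : T -> E) n i :
  (forall a, measurable_fun setT (fun t => `|X t - a|)) ->
  measurable [set t | nearest n (X t) = i].
Proof.
move=> mX.
have mP (Q : Prop) : measurable [set _ : T | Q].
  have [q|q] := pselect Q; first by rewrite (_ : [set _ | _] = setT)//; apply/seteqP; split.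
  by rewrite (_ : [set _ | _] = set0)//; apply/seteqP; split.
elim: n i => [|n IH] i.
  exact: (mP (0%N = i)).
pose A j := [set t | `|X t - y n.+1| < `|X t - y j|].
have mA j : measurable (A j).
  have := measurable_fun_ltr (mX (y n.+1)) (mX (y j)).
  by move=> /(_ measurableT [set true]); rewrite setTI; exact.
pose L j := [set t | nearest n (X t) = j].
have -> : [set t | nearest n.+1 (X t) = i] =
    ([set t | n.+1 = i] `&` \bigcup_j (L j `&` A j)) `|` (L i `\` A i).
  apply/seteqP; split=> t /=.
    case: ifPn => h ti; first by left; split=> //; exists (nearest n (X t)).
    right; split => //; rewrite /A /= -ti; exact/negP.
  move=> [[ni [j _ [/= <- At]]]|[/= <- /negP/negPf ->]//].
  by rewrite /A/= in At; rewrite At.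
apply: measurableU; last by apply: measurableD => //; exact: IH.
apply: measurableI; first exact: mP.
by apply: bigcup_measurable => j _; apply: measurableI => //; exact: IH.
Qed.

Lemma nearest_borel n i : borel_set [set x | nearest n x = i].
Proof.
pose T := g_sigma_algebraType (@open E).
apply: (@nearest_measurable _ T id) => a.
apply: (measurability _ (RGenOpens.measurableE R)) => _ [_ [u [v ->]] <-].
rewrite setTI; apply: sub_sigma_algebra.
apply: open_comp; last exact: interval_open.
move=> x _; apply: (@continuous_comp _ _ _ (fun t : E => t - a)); last exact: norm_continuous.
by apply: cvgB; [exact: cvg_id|exact: cvg_cst].
Qed.

Hypothesis y0 : y 0%N = 0.

(** As 0 is one of the points, the discretization error is at most |x| for every n: this is the
    domination behind all passages to the limit. *)
Lemma nearest_dist n x : `|x - y (nearest n x)| <= `|x|.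
Proof. by have := @nearest_min n x 0%N isT; rewrite y0 subr0. Qed.

Lemma nearest_norm n x : `|y (nearest n x)| <= 2 * `|x|.
Proof.
rewrite -(subrK x (y _)); apply: (le_trans (ler_normD _ _)).
by rewrite distrC mulr2n mulrDl mul1r lerD2r nearest_dist.
Qed.

End Nearest.

(** The points are all values of the approximating simple functions. Their countability replaces
    separability of E, and one sequence serves the whole finite family. *)
Lemma bochner_adherent (R : realType) (d : measure_display) (Omega : measurableType d)
    (P : probability Omega R) (E : normedModType R) (J : finType) (X : J -> Omega -> E) :
  (forall j, bochner_measurable P (X j)) ->
  exists y : nat -> E, y 0%N = 0 /\ {ae P, forall w j, adherent y (X j w)}.
Proof.
move=> /choice[s hs].
have /choice[l hl] : forall jn : J * nat, exists l : seq E, forall w, s jn.1 jn.2 w \in l.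
  move=> [j n]; have [ss _] := hs j; have [/finite_seqP[l ls] _] := ss n.
  exists l => w; have : range (s j n) (s j n w) by exists w.
  by rewrite ls.
(* Index 0 is reserved for the zero vector; codes that name no value also give 0. *)
pose y (m : nat) : E := if m is m'.+1 then
  if @unpickle (J * nat * nat)%type m' is Some (jn, i) then nth 0 (l jn) i else 0 else 0.
exists y; split => //.
apply: filter_forall => j; have [_] := hs j; apply: filterS => w sX e e0.
move/cvgrPdist_lt : sX => /(_ e e0)[n _ /(_ n (leqnn n)) /= sn].
exists (pickle ((j, n), index (s j n w) (l (j, n)))).+1.
by rewrite /y pickleK nth_index//; exact: (hl (j, n)).
Qed.

(** * Convergence of the discretized moments *)

(** For x > 0 the power is exp(q ln u). At x = 0 the logarithm is of no help, and u < e^(1/q) is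
    used directly. *)
Lemma cvg_powR (R : realType) (q x : R) (u : nat -> R) : 0 < q ->
  (forall n, 0 <= u n) -> u n @[n --> \oo] --> x -> u n `^ q @[n --> \oo] --> x `^ q.
Proof.
move=> q0 u0 ux; have x0 : 0 <= x by apply: (ler_cvg_to (cvg_cst 0) ux); exact: nearW.
move: x0; rewrite le_eqVlt => /predU1P[x0|x0].
  rewrite -x0 powR0 ?gt_eqF//; apply/cvgr0Pnorm_lt => e e0.
  rewrite -x0 in ux; have e0' : 0 < e `^ q^-1 by rewrite powR_gt0.
  move/cvgr0Pnorm_lt : ux => /(_ _ e0'); apply: filterS => n.
  rewrite !ger0_norm ?powR_ge0// => h.
  have -> : e = (e `^ q^-1) `^ q by rewrite -powRrM mulVf ?gt_eqF// powRr1// ltW.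
  by rewrite gt0_ltr_powR ?nnegrE ?powR_ge0.
have h : expR (q * ln (u n)) @[n --> \oo] --> expR (q * ln x).
  apply: (continuous_cvg _ (@continuous_expR R _)); apply: cvgMr.
  exact: (continuous_cvg _ (continuous_ln x0)).
rewrite {2}/powR gt_eqF//; apply: cvg_trans h; apply: near_eq_cvg.
have : \forall n \near \oo, 0 < u n by exact: (cvgr_gt x ux).
by apply: filterS => n un; rewrite /powR gt_eqF.
Qed.

Section PowerMaps.
Context (R : realType).

(* The factor in [s ^+ k - t ^+ k = (s - t) * power_gap k s t]. *)
Definition power_gap (k : nat) (s t : R) : R := \sum_(i < k) s ^+ i * t ^+ (k - i - 1).

Lemma power_gap_ge0 k s t : 0 <= s -> 0 <= t -> 0 <= power_gap k s t.
Proof. by move=> s0 t0; apply: sumr_ge0 => i _; rewrite mulr_ge0// exprn_ge0. Qed.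

Lemma power_gapS k s t : power_gap k.+1 s t = s ^+ k + t * power_gap k s t.
Proof.
rewrite /power_gap big_ord_recr/= subSnn subnn expr0 mulr1 addrC; congr (_ + _).
rewrite mulr_sumr; apply: eq_bigr => i _; rewrite mulrCA -exprS; congr (_ * _ ^+ _).
by rewrite subn1 subSn ?subn1 ?prednK ?subn_gt0// ltnW.
Qed.

Lemma power_gap_le k s t A : 0 <= s <= A -> 0 <= t <= A ->
  power_gap k s t <= k%:R * A ^+ k.-1.
Proof.
move=> /andP[s0 sA] /andP[t0 tA]; have A0 : 0 <= A by exact: le_trans sA.
rewrite -[k in k%:R]card_ord -sum1_card natr_sum mulr_suml; apply: ler_sum => i _.
have -> : k.-1 = (i + (k - i - 1))%N by have := ltn_ord i; lia.
by rewrite mul1r exprD; apply: ler_pM; rewrite ?exprn_ge0// lerXn2r ?nnegrE.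
Qed.

Context (E F : normedModType R) (k : nat) (tau : E -> F).

(* Shared by both tensor power maps [x |-> x^(k)]. *)
Definition power_lipschitz := forall x z : E,
  `|tau x - tau z| <= `|x - z| * power_gap k `|x| `|z|.

Hypothesis tauP : power_lipschitz.

Lemma power_lipschitz_continuous : continuous tau.
Proof.
(* A bound for [power_gap] on the unit ball around a, increased by 1 so that one may divide by
   it. *)
move=> a; pose C := k%:R * (`|a| + 1) ^+ k.-1 + 1.
have C0 : 0 < C by rewrite ltr_wpDl// mulr_ge0 ?exprn_ge0 ?addr_ge0.
apply/cvgrPdist_lt => e e0; near=> x.
have xa1 : `|a - x| < 1 by near: x; exact: (@cvgr_dist_lt _ _ _ _ _ id a).
have xae : `|a - x| < e / C.
  by near: x; apply: (@cvgr_dist_lt _ _ _ _ _ id a) => //; rewrite divr_gt0.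
apply: (le_lt_trans (tauP a x)); apply: le_lt_trans (_ : `|a - x| * C < _).
  rewrite ler_wpM2l//; apply: le_trans (_ : k%:R * (`|a| + 1) ^+ k.-1 <= _); last by rewrite lerDl.
  apply: power_gap_le; first by rewrite normr_ge0 lerDl/=.
  rewrite normr_ge0/= -(subrK a x); apply: (le_trans (ler_normD _ _)).
  by rewrite addrC lerD2l distrC ltW.
by rewrite -ltr_pdivlMr.
Unshelve. all: by end_near.
Qed.

End PowerMaps.

Section Discretization.
Context (R : realType) (d : measure_display) (Omega : measurableType d).
Context (P : probability Omega R) (cP : measure_is_complete P).
Context (E : normedModType R) (y : nat -> E) (y0 : y 0%N = 0).

Definition cell (n : nat) (X : Omega -> E) (w : Omega) : 'I_n.+1 := inord (nearest y n (X w)).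

Lemma cellE n X w : cell n X w = nearest y n (X w) :> nat.
Proof. by rewrite inordK// ltnS nearest_le. Qed.

Lemma cell_preimage n X (i : 'I_n.+1) :
  cell n X @^-1` [set i] = X @^-1` [set x | nearest y n x = i].
Proof.
apply/seteqP; split=> w /= h; first by rewrite -cellE h.
by apply: val_inj; rewrite /= cellE.
Qed.

Context (X : Omega -> E) (bX : bochner_measurable P X).
Hypothesis aX : {ae P, forall w, adherent y (X w)}.

Lemma cell_measurable n i : measurable (cell n X @^-1` [set i]).
Proof.
rewrite cell_preimage; apply: (@nearest_measurable _ _ y _ _ X n i) => a.
apply: (bochner_dist_measurable cP bX); apply: simple_rv_bochner.
exact: simple_rv_cst.
Qed.

Context (k : nat) (k_gt0 : (0 < k)%N).
Hypothesis iX : (\int[P]_w (`|X w| ^+ k)%:E < +oo)%E.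

Lemma scale_integrable (h : Omega -> R) (c : R) : measurable_fun setT h ->
  (forall w, 0 <= h w) -> (\int[P]_w (h w)%:E < +oo)%E -> 0 <= c ->
  P.-integrable setT (fun w => (c * h w)%:E).
Proof.
move=> mh h0 ih c0; apply/integrableP; split.
  by apply/measurable_EFinP; exact: measurable_realfun.measurable_funM.
rewrite (eq_integral (fun w => c%:E * (h w)%:E)%E); last first.
  by move=> w _; rewrite gee0_abs ?lee_fin ?mulr_ge0// EFinM.
rewrite ge0_integralZl_EFin//.
- exact: lte_mul_pinfty.
- by move=> w _; rewrite lee_fin.
- exact/measurable_EFinP.
Qed.

Lemma norm_exp_measurable : measurable_fun setT (fun w => `|X w| ^+ k).
Proof. by apply: measurable_funX; exact: (bochner_norm_measurable cP bX). Qed.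

(** Dominated convergence with |y| <= 2 |X|; it supplies the convergent right-hand sides for Fatou's
    lemma. *)
Lemma discretization_moment_cvg (q : R) : 0 < q ->
  (\int[P]_w ((`|X w| ^+ k) `^ q)%:E < +oo)%E ->
  (\int[P]_w ((`|y (nearest y n (X w))| ^+ k) `^ q)%:E)%E @[n --> \oo] -->
  (\int[P]_w ((`|X w| ^+ k) `^ q)%:E)%E.
Proof.
move=> q0 iq; pose g w := (`|X w| ^+ k) `^ q.
have mg : measurable_fun setT g.
  exact: (measurableT_comp (measurable_powR q) norm_exp_measurable).
have [] // := @dominated_convergence _ _ _ P setT measurableT
    (fun n w => ((`|y (nearest y n (X w))| ^+ k) `^ q)%:E) (fun w => (g w)%:E)
    (fun w => ((2 ^+ k) `^ q * g w)%:E).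
- move=> n; apply/measurable_EFinP.
  rewrite (_ : (fun w => _) = (fun w => (`|y (cell n X w)| ^+ k) `^ q)); last first.
    by apply/funext => w; rewrite cellE.
  exact: (coded_measurable_fun (fun i : 'I_n.+1 => (`|y i| ^+ k) `^ q) (cell_measurable (n := n))).
- exact/measurable_EFinP.
- apply: filterS aX => w aw _; apply: cvg_EFinW; apply: cvg_powR => //.
  exact: (continuous_cvg _ (@exprn_continuous R k `|X w|) (cvg_norm (nearest_cvg aw))).
- by apply: scale_integrable => // w; exact: powR_ge0.
- apply: aeW => w n _; rewrite gee0_abs ?lee_fin ?powR_ge0// -powRM ?exprn_ge0//.
  rewrite -exprMn ge0_ler_powR ?nnegrE ?exprn_ge0 ?mulr_ge0 ?(ltW q0)//.
  by rewrite lerXn2r ?nnegrE ?mulr_ge0// nearest_norm.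
Qed.

Context (F : normedModType R) (tau : E -> F) (tauP : power_lipschitz k tau).

Definition discretization n w : F := tau (y (cell n X w)).

Lemma discretization_simple n : simple_rv (discretization n).
Proof. exact: (coded_simple_rv (fun i : 'I_n.+1 => tau (y i)) (cell_measurable (n := n))). Qed.

Lemma discretization_expectation n : simple_expectation P (discretization n) =
  \sum_i law P (cell n X) i *: tau (y i).
Proof. exact: (coded_expectation P (cell_measurable (n := n)) (fun i => tau (y i))). Qed.

Lemma discretization_cvg : {ae P, forall w, discretization n w @[n --> \oo] --> tau (X w)}.
Proof.
apply: filterS aX => w aw; rewrite /discretization.
under eq_fun do rewrite cellE.
exact: (continuous_cvg _ (power_lipschitz_continuous tauP (x := X w)) (nearest_cvg aw)).
Qed.

Lemma tau_bochner : bochner_measurable P (tau \o X).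
Proof. by apply: bochner_measurable_comp bX; exact: power_lipschitz_continuous. Qed.

Lemma discretization_L1 :
  (\int[P]_w `|tau (X w) - discretization n w|%:E)%E @[n --> \oo] --> 0%E.
Proof.
pose f_ n w := `|tau (X w) - discretization n w|.
have mf n : measurable_fun setT (f_ n).
  apply: (bochner_dist_measurable cP) tau_bochner _.
  by apply: simple_rv_bochner; exact: discretization_simple.
(* The dominating function is |X| * k (2 |X|)^(k-1): the distance to the nearest point is at most
   |X|, and both arguments of [power_gap] are at most 2 |X|. *)
have [] // := @dominated_convergence _ _ _ P setT measurableT (fun n w => (f_ n w)%:E)
    (fun=> 0%E) (fun w => (k%:R * 2 ^+ k.-1 * `|X w| ^+ k)%:E).
- by move=> n; exact/measurable_EFinP.
- apply: filterS discretization_cvg => w hw _; apply: cvg_EFinW.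
  rewrite /f_ -(@normr0 _ F) -(subrr (tau (X w))); apply: cvg_norm.
  by apply: cvgB => //; exact: cvg_cst.
- by apply: scale_integrable => //; exact: norm_exp_measurable.
- apply: aeW => w n _; rewrite gee0_abs ?lee_fin ?normr_ge0// /f_ /discretization.
  apply: (le_trans (tauP _ _)).
  rewrite cellE; set z := y _.
  apply: le_trans (_ : `|X w| * (k%:R * (2 * `|X w|) ^+ k.-1) <= _).
    apply: ler_pM => //; first exact: power_gap_ge0.
      exact: nearest_dist.
    apply: power_gap_le; rewrite normr_ge0 /=; last exact: nearest_norm.
    by rewrite ler_peMl// ler1n.
  have -> : `|X w| ^+ k = `|X w| * `|X w| ^+ k.-1 by rewrite -exprS prednK.
  by rewrite exprMn; apply: eq_ler; ring.
- by move=> _ _; rewrite integral0; exact.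
Qed.

Lemma discretization_bochner_integral (v : F) :
  simple_expectation P (discretization n) @[n --> \oo] --> v ->
  is_bochner_integral P (tau \o X) v.
Proof.
move=> hv; split; first exact: tau_bochner.
by exists discretization; split => //; [exact: discretization_simple|exact: discretization_L1].
Qed.

End Discretization.

(** Telescoping at the last factor: the induction reproduces the recursion [power_gapS]. *)
Lemma prod_dist (R : realType) (k : nat) (a b : 'I_k -> R) (A B e : R) :
  0 <= A -> 0 <= B ->
  (forall i, `|a i| <= A) -> (forall i, `|b i| <= B) -> (forall i, `|a i - b i| <= e) ->
  `|\prod_i a i - \prod_i b i| <= e * power_gap k A B.
Proof.
move=> A0 B0; elim: k a b => [|k IH] a b aA bB ab.
  by rewrite !big_ord0 subrr normr0 /power_gap big_ord0 mulr0.
have e0 : 0 <= e by exact: le_trans (ab ord0).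
rewrite !big_ord_recr/= power_gapS mulrDr.
set a' := \prod_(i < k) _; set b' := \prod_(i < k) _.
have -> : a' * a ord_max - b' * b ord_max =
    a' * (a ord_max - b ord_max) + (a' - b') * b ord_max by ring.
apply: (le_trans (ler_normD _ _)); rewrite !normrM; apply: lerD.
  rewrite mulrC ler_pM//; rewrite normr_prod.
  apply: le_trans (_ : \prod_(i < k) A <= _); last by rewrite prodr_const card_ord.
  by apply: ler_prod => i _; rewrite normr_ge0 aA.
rewrite [leRHS]mulrA [e * B]mulrC -mulrA mulrC.
by apply: ler_pM => //; exact: IH.
Qed.

(** * Tensor powers and their discretized moments *)

Section TensorMoments.
Context (R : realType) (E : normedModType R) (k : nat).

Lemma inj_norm_dist (x z : E) :
  inj_norm (elementary_tensor (fun _ : 'I_k => x) - elementary_tensor (fun=> z)) <=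
  `|x - z| * power_gap k `|x| `|z|.
Proof.
apply: inj_norm_le => f hf.
rewrite [X in `|X|](_ : _ = \prod_n f n x - \prod_n f n z)//.
apply: prod_dist => // n; try exact: dual_ball_le.
by rewrite -linearB; exact: dual_ball_le.
Qed.

Lemma tensor_pow_lipschitz : power_lipschitz k (@tensor_pow R k E).
Proof.
by move=> x z; rewrite /tensor_pow -linearB completion_in_norm; exact: inj_norm_dist.
Qed.

Lemma sym_inj_norm_le_inj (U : sym_tensor_power k E) : sym_inj_norm U <= inj_norm U.
Proof. by apply: sym_inj_norm_le => f hf; exact: inj_norm_ub. Qed.

Lemma sym_tensor_pow_lipschitz : power_lipschitz k (@sym_tensor_pow R k E).
Proof.
move=> x z; rewrite /sym_tensor_pow -linearB completion_in_norm -[X in X <= _]/(sym_inj_norm _).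
apply: le_trans (sym_inj_norm_le_inj _) _.
rewrite -[X in inj_norm X]/(elementary_tensor (fun _ : 'I_k => x) - elementary_tensor (fun=> z)).
exact: inj_norm_dist.
Qed.

Lemma completion_in_sum (I : Type) (r : seq I) (c : I -> R) (x : I -> E) :
  completion_in (inj_seminorm k E)
    (\sum_(i <- r) c i *: diagonal_tensor k (x i) : sym_tensor_power k E) =
  \sum_(i <- r) c i *: tensor_pow k (x i).
Proof.
elim: r => [|i r IH]; first by rewrite !big_nil -[LHS]/(completion_in _ 0) linear0.
rewrite !big_cons -IH -[LHS]/(completion_in _ (c i *: elementary_tensor (fun=> x i) + _)).
by rewrite linearD linearZ.
Qed.

Lemma sym_tensor_pow_cvg (u : nat -> E) (a : E) : u n @[n --> \oo] --> a ->
  sym_tensor_pow k (u n) @[n --> \oo] --> sym_tensor_pow k a.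
Proof.
move=> ua; have ca := power_lipschitz_continuous sym_tensor_pow_lipschitz (x := a).
exact: (continuous_cvg _ ca ua).
Qed.

(** The symmetric norm is at most the injective one, so two sequences with the same limit in the
    injective completion differ by a null sequence in the symmetric one. *)
Lemma same_tensor_unique (m m' : sym_inj_tensor_power k E) (v : inj_tensor_power k E) :
  same_tensor m v -> same_tensor m' v -> m = m'.
Proof.
move=> [u [um uv]] [u' [um' uv']]; apply/eqP; rewrite -subr_eq0 -normr_le0.
have c1 : `|completion_in (sym_inj_seminorm k E) (u n) -
    completion_in (sym_inj_seminorm k E) (u' n)| @[n --> \oo] --> `|m - m'|.
  by apply: cvg_norm; exact: cvgB.
have c2 : `|completion_in (inj_seminorm k E) (u n) -
    completion_in (inj_seminorm k E) (u' n)| @[n --> \oo] --> (0 : R).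
  by rewrite -(@normr0 _ (inj_tensor_power k E)) -(subrr v); apply: cvg_norm; exact: cvgB.
apply: (ler_cvg_to c1 c2); apply: nearW => n /=.
rewrite -linearB completion_in_norm.
rewrite -[X in _ <= `|X - _|]/(completion_in _ (val (u n))) -linearB completion_in_norm.
exact: (sym_inj_norm_le_inj (u n - u' n)).
Qed.

Context (d : measure_display) (Omega : measurableType d).
Context (P : probability Omega R) (cP : measure_is_complete P) (k_gt0 : (0 < k)%N).

(** Kept in the algebraic symmetric tensor power, so that one sequence can be sent into both
    completions, as [same_tensor] demands. *)
Definition moment_approx (y : nat -> E) (X : Omega -> E) (n : nat) : sym_tensor_power k E :=
  \sum_i law P (cell y n X) i *: diagonal_tensor k (y i).

Section OneVariable.
Context (y : nat -> E) (y0 : y 0%N = 0) (X : Omega -> E) (bX : bochner_measurable P X).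
Hypothesis aX : {ae P, forall w, adherent y (X w)}.
Hypothesis iX : (\int[P]_w (`|X w| ^+ k)%:E < +oo)%E.
Local Notation D n := (discretization y X (@tensor_pow R k E) n).

Lemma moment_approxE n : simple_expectation P (D n) =
  completion_in (inj_seminorm k E) (moment_approx y X n).
Proof. by rewrite discretization_expectation// completion_in_sum. Qed.

Lemma sym_moment_approxE n :
  simple_expectation P (discretization y X (@sym_tensor_pow R k E) n) =
  completion_in (sym_inj_seminorm k E) (moment_approx y X n).
Proof.
rewrite discretization_expectation// /moment_approx linear_sum.
by apply: eq_bigr => i _; rewrite linearZ.
Qed.

(** Expectations of simple functions are 1-Lipschitz for the L_1 distance, in which the
    discretizations converge. The Cauchy property is shown in the larger of the two norms and passes
    to the smaller. *)
Lemma moment_approx_cauchy : forall e : R, 0 < e -> exists n0 : nat, forall i j : nat,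
  (n0 <= i)%N -> (n0 <= j)%N -> inj_norm (moment_approx y X i - moment_approx y X j) < e.
Proof.
move=> e e0.
have L1 := discretization_L1 cP y0 bX aX k_gt0 iX tensor_pow_lipschitz.
have e2 : (0 < (e / 2)%:E)%E by rewrite lte_fin divr_gt0.
have : \forall n \near \oo, (\int[P]_w `|tensor_pow k (X w) - D n w|%:E < (e / 2)%:E)%E.
  apply: (L1 [set x | (x < (e / 2)%:E)%E]); apply: open_nbhs_nbhs; split => //.
  exact: open_ereal_lt_ereal.
case=> n0 _ hn0; exists n0 => i j /hn0 /= hi /hn0 /= hj.
have s n : simple_rv (D n) by apply: (discretization_simple cP).
have b n := simple_rv_bochner P (s n).
have bt : bochner_measurable P (@tensor_pow R k E \o X).
  by apply: bochner_measurable_comp bX; exact: (power_lipschitz_continuous tensor_pow_lipschitz).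
rewrite -lte_fin; have := simple_expectation_dist P (s i) (s j).
rewrite !moment_approxE -linearB completion_in_norm => /le_lt_trans; apply.
apply: (le_lt_trans (bochner_dist_triangle cP (b i) bt (b j))).
rewrite (splitr e) EFinD.
have h1 : (\int[P]_w `|D i w - (@tensor_pow R k E \o X) w|%:E < (e / 2)%:E)%E.
  rewrite bochner_distC; exact: hi.
apply: lteD; first exact: h1.
exact: hj.
Qed.

(** Both moments are defined by choice with a default value. Here they are shown to exist: the limit
    in the injective completion is the Bochner integral, and the limit in the symmetric completion
    is its only partner under [same_tensor]. *)
Lemma sym_inj_moment_cvg :
  completion_in (sym_inj_seminorm k E) (moment_approx y X n) @[n --> \oo] -->
  sym_inj_moment P k X.
Proof.
have uc : (moment_approx y X : nat -> tensor_power k E) \in is_cauchy_seq (inj_seminorm k E).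
  by apply/asboolP; exact: moment_approx_cauchy.
have sc : moment_approx y X \in is_cauchy_seq (sym_inj_seminorm k E).
  apply/asboolP => e /moment_approx_cauchy[n0 hn0]; exists n0 => i j /hn0 h /h.
  exact: le_lt_trans (sym_inj_norm_le_inj _).
have cu := cvg_completion_in (CauchySeq uc).
have cs := cvg_completion_in (CauchySeq sc).
suff -> : sym_inj_moment P k X = completion_class (CauchySeq sc) by exact: cs.
have im : inj_moment P k X = completion_class (CauchySeq uc).
  apply: (bochner_integralE cP).
  apply: (discretization_bochner_integral cP y0 bX aX k_gt0 iX tensor_pow_lipschitz).
  by under eq_fun do rewrite moment_approxE.
have same : same_tensor (completion_class (CauchySeq sc)) (completion_class (CauchySeq uc)).
  by exists (moment_approx y X).
rewrite /sym_inj_moment im; apply: xget_unique => // m' sm'; exact: same_tensor_unique sm' same.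
Qed.

End OneVariable.
End TensorMoments.

(** * The Monte Carlo error *)

Section MonteCarlo.
Context (R : realType) (d : measure_display) (Omega : measurableType d).
Context (P : probability Omega R) (cP : measure_is_complete P).
Context (E : normedModType R) (k M : nat) (p q K : R).
Context (k_gt0 : (0 < k)%N) (M_gt0 : (0 < M)%N) (p_ge1 : 1 <= p) (pq : p <= q).
Context (K_ge0 : 0 <= K) (hK : rademacher_bound E p q M K).
Context (xi : 'I_M -> Omega -> E) (j1 : 'I_M).
Hypotheses (bxi : forall j, bochner_measurable P (xi j)).
Hypotheses (ixi : (\int[P]_w (`|xi j1 w| ^+ k)%:E < +oo)%E).
Hypotheses (iqxi : (\int[P]_w ((`|xi j1 w| ^+ k) `^ q)%:E < +oo)%E).
Hypotheses (indep : independent_rvs P xi) (ident : identically_distributed P xi).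

Section Cells.
Context (y : nat -> E) (y0 : y 0%N = 0).

Definition joint_cell n w : {ffun 'I_M -> 'I_n.+1} := [ffun j => cell y n (xi j) w].

Lemma joint_cell_preimage n (i : {ffun 'I_M -> 'I_n.+1}) :
  joint_cell n @^-1` [set i] =
  \bigcap_(j in [set` [set: 'I_M]%SET]) xi j @^-1` [set x | nearest y n x = i j].
Proof.
apply/seteqP; split=> [w /= <- j _|w /= wi].
  by rewrite -cell_preimage /= ffunE.
apply/ffunP => j; rewrite ffunE; have := wi j; rewrite /= finset.in_setT => /(_ isT).
by rewrite -[X in X -> _]/((xi j @^-1` [set x | nearest y n x = i j]) w) -cell_preimage.
Qed.

Lemma xi_cell_measurable j n i : measurable (cell y n (xi j) @^-1` [set i]).
Proof. exact: (@cell_measurable R d Omega P cP E y _ (bxi j) n i). Qed.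

Lemma joint_cell_measurable n i : measurable (joint_cell n @^-1` [set i]).
Proof.
rewrite joint_cell_preimage; apply: fin_bigcap_measurable => // j _.
by rewrite -cell_preimage; exact: xi_cell_measurable.
Qed.

(** Independence and identical distribution enter here, on the Borel cells of the nearest-point
    map. *)
Lemma law_joint_cell n i :
  law P (joint_cell n) i = product_law (law P (cell y n (xi j1))) i.
Proof.
apply: EFin_inj; rewrite lawE; last exact: joint_cell_measurable.
rewrite joint_cell_preimage indep; last by move=> j; exact: nearest_borel.
rewrite /product_law -prodEFin; apply: eq_big => [j|j _]; first by rewrite finset.in_setT.
rewrite lawE; last exact: xi_cell_measurable.
by rewrite cell_preimage; apply: ident; exact: nearest_borel.
Qed.

End Cells.

Definition monte_carlo_error w : sym_inj_tensor_power k E :=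
  sym_inj_moment P k (xi j1) - M%:R^-1 *: \sum_j sym_tensor_pow k (xi j w).

Lemma monte_carlo_moment :
  (\int[P]_w (`|monte_carlo_error w| `^ q)%:E <=
   ((4 * k%:R * K * M%:R `^ (- (1 - p^-1))) `^ q)%:E *
   \int[P]_w ((`|xi j1 w| ^+ k) `^ q)%:E)%E.
Proof.
have q0 : 0 < q by apply: lt_le_trans pq; exact: lt_le_trans p_ge1.
have [y [y0 ay]] := bochner_adherent bxi.
have ay1 : {ae P, forall w, adherent y (xi j1 w)} by apply: filterS ay.
set C := 4 * k%:R * K * M%:R `^ (- (1 - p^-1)).
pose I := completion_in (sym_inj_seminorm k E).
(* The moment and the sample are discretized with the same points, so the centre is the exact mean
   of the finite law and [monte_carlo_finite_law] applies for every n. *)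
pose g n (i : {ffun 'I_M -> 'I_n.+1}) : R := `|I (moment_approx k P y (xi j1) n) -
   M%:R^-1 *: \sum_j sym_tensor_pow k (y (i j))| `^ q.
apply: (@fatou_ae _ _ _ P cP (fun n w => g n (joint_cell y n w)) _
  (fun n => ((C `^ q)%:E * \int[P]_w ((`|y (nearest y n (xi j1 w))| ^+ k) `^ q)%:E)%E)).
- by move=> n; apply: coded_measurable_fun => i; exact: joint_cell_measurable.
- by move=> n w; exact: powR_ge0.
- by move=> w; exact: powR_ge0.
- apply: filterS ay => w aw; apply: cvg_powR => //; apply: cvg_norm; apply: cvgB.
    exact: sym_inj_moment_cvg.
  apply: cvgZ; first exact: cvg_cst.
  apply: (cvg_big add_continuous) => j _.
  have -> : (fun n => sym_tensor_pow k (y (joint_cell y n w j))) =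
      (fun n => sym_tensor_pow k (y (nearest y n (xi j w)))).
    by apply/funext => n; rewrite ffunE cellE.
  exact: (sym_tensor_pow_cvg (nearest_cvg (aw j))).
- move=> n; rewrite (coded_integral P (@joint_cell_measurable y n)); last first.
    by move=> i; exact: powR_ge0.
  have -> : (\int[P]_w ((`|y (nearest y n (xi j1 w))| ^+ k) `^ q)%:E)%E =
      (\sum_a law P (cell y n (xi j1)) a * (`|y a| ^+ k) `^ q)%:E.
    rewrite -(coded_integral P (@xi_cell_measurable y j1 n)); last by move=> a; exact: powR_ge0.
    by apply: eq_integral => w _; rewrite cellE.
  rewrite -EFinM lee_fin.
  under eq_bigr do rewrite law_joint_cell//.
  have := @monte_carlo_finite_law R E k M 'I_n.+1 p q K (law P (cell y n (xi j1)))
    (fun i => y i) k_gt0 M_gt0 p_ge1 pq K_ge0 hK.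
  move=> /(_ (law_ge0 P _) (law_sum P (@xi_cell_measurable y j1 n))).
  apply: le_trans; apply: ler_sum => i _; rewrite ler_wpM2l//.
    by apply: product_law_ge0; exact: law_ge0.
  apply: eq_ler; congr (_ `^ q).
  rewrite -[RHS]/(sym_inj_seminorm k E _) -completion_in_norm; congr `|_|.
  rewrite [RHS]linearB; congr (_ - _); rewrite [RHS]linearZ; congr (_ *: _).
  by rewrite [RHS]linear_sum.
- apply: cvgeZl => //.
  exact: discretization_moment_cvg.
Qed.

End MonteCarlo.

(** * Random signs *)

Section SignSpace.
Context (R : realType) (M : nat).
Local Notation signs := {ffun 'I_M -> bool}.

(* The uniform space of sign vectors is realized on an initial segment of [nat],
   whose discrete sigma-algebra makes every measure complete. *)
Definition nth_signs (n : nat) : signs := nth [ffun=> false] (enum [set: signs]%SET) n.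

Fact signs_weight_ge0 : 0 <= (2 ^+ M)^-1 :> R.
Proof. by rewrite invr_ge0 exprn_ge0. Qed.

Definition signs_weight : {nonneg R} := NngNum signs_weight_ge0.

(** [kahane_khintchine_bound] and [type_bound] quantify over complete probability spaces with a
    Rademacher family. Instantiated here they become inequalities between sums over sign vectors. *)
Definition sign_measure : set nat -> \bar R :=
  msum (fun i => mscale signs_weight (@dirac _ nat i R)) #|signs|.

HB.instance Definition _ := Measure.on sign_measure.

Lemma sum_nth_signs (V : nmodType) (G : signs -> V) :
  \sum_(i < #|signs|) G (nth_signs i) = \sum_e G e.
Proof.
rewrite -(big_mkord xpredT (fun i => G (nth_signs i))).
have -> : #|signs| = size (enum [set: signs]%SET) by rewrite -cardE cardsT.
by rewrite -(big_nth _ xpredT G) big_enum/=; apply: eq_bigl => e; rewrite finset.in_setT.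
Qed.

Lemma integral_signs (G : signs -> R) : (forall e, 0 <= G e) ->
  (\int[sign_measure]_n (G (nth_signs n))%:E = ((2 ^+ M)^-1 * \sum_e G e)%:E)%E.
Proof.
move=> G0; have mG : measurable_fun [set: nat] (fun n => (G (nth_signs n))%:E) by [].
rewrite ge0_integral_measure_sum//; last by move=> n _; rewrite lee_fin.
rewrite -sum_nth_signs mulr_sumr -sumEFin; apply: eq_bigr => i _.
rewrite ge0_integral_mscale//; last by move=> n _; rewrite lee_fin.
by rewrite integral_dirac// diracT mul1e.
Qed.

Lemma sign_measureE (B : set signs) :
  sign_measure (nth_signs @^-1` B) = ((2 ^+ M)^-1 * \sum_e (\1_B e : R))%:E.
Proof.
rewrite -integral_signs; last by move=> e; rewrite indicE.
transitivity (\int[sign_measure]_n (\1_(nth_signs @^-1` B) n)%:E)%E.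
  by rewrite integral_indic// setIT.
by apply: eq_integral => n _; rewrite !indicE.
Qed.

Lemma sign_measure_setT : sign_measure setT = 1%E.
Proof.
have -> : [set: nat] = nth_signs @^-1` setT by [].
rewrite sign_measureE; congr (_%:E).
under eq_bigr do rewrite indicT.
rewrite sumr_const card_ffun card_bool card_ord natrX mulVf//.
Qed.

HB.instance Definition _ := Measure_isProbability.Build _ _ _ sign_measure sign_measure_setT.

Lemma sign_measure_complete : measure_is_complete sign_measure.
Proof. by []. Qed.

Definition sign_rv (j : 'I_M) (n : nat) : R := (-1) ^+ nth_signs n j.

Lemma sum_signs_prod (h : 'I_M -> bool -> R) :
  (2 ^+ M)^-1 * \sum_(e : signs) \prod_j h j (e j) = \prod_j (2^-1 * \sum_b h j b).
Proof.
rewrite -bigA_distr_bigA big_split/= prodr_const card_ord; congr (_ * _).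
by rewrite exprVn.
Qed.

Lemma sign_cylinder (J : {set 'I_M}) (A : 'I_M -> set R) :
  sign_measure (\bigcap_(i in [set` J]) sign_rv i @^-1` A i) =
  (\prod_(i in J) (2^-1 * \sum_b (\1_(A i) ((-1) ^+ (b : bool)))))%:E.
Proof.
pose B := [set e : signs | forall i, i \in J -> A i ((-1) ^+ e i)].
have -> : \bigcap_(i in [set` J]) sign_rv i @^-1` A i = nth_signs @^-1` B by [].
rewrite sign_measureE; congr (_%:E).
(* The indicator of [B] as a product over all coordinates, with factor 1 outside J. *)
pose h i (b : bool) : R := if i \in J then \1_(A i) ((-1) ^+ b) else 1.
transitivity ((2 ^+ M)^-1 * \sum_(e : signs) \prod_j h j (e j)).
  congr (_ * _); apply: eq_bigr => e _; rewrite indicE; have [Be|Be] := pselect (B e).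
    rewrite mem_set// big1// => i _; rewrite /h; case: ifP => // iJ.
    by rewrite indicE mem_set//; exact: Be.
  rewrite memNset//; apply/esym/eqP; apply/prodf_eq0.
  have [i /not_implyP[iJ nA]] : exists i, ~ (i \in J -> A i ((-1) ^+ e i)) by exact/existsNP.
  by exists i => //; rewrite /h iJ indicE memNset.
rewrite sum_signs_prod [RHS]big_mkcond/=; apply: eq_bigr => i _.
rewrite /h; case: ifP => // _; rewrite big_bool/=.
by field.
Qed.

Lemma sign_marginal i A :
  sign_measure (sign_rv i @^-1` A) = (2^-1 * \sum_b \1_A ((-1) ^+ (b : bool)))%:E.
Proof.
have := sign_cylinder [set i]%SET (fun=> A); rewrite big_set1 => <-.
congr sign_measure; apply/seteqP; split=> [n An j /=|n /(_ i)/=]; rewrite finset.in_set1.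
  by move=> /eqP ->.
by rewrite eqxx; exact.
Qed.

Lemma sign_rv_rademacher : rademacher_family sign_measure sign_rv.
Proof.
split=> // [i n|i|J A _].
- by rewrite /sign_rv; case: (nth_signs n i); [right; rewrite expr1|left; rewrite expr0].
- have n1 : (1 == -1 :> R) = false by apply/eqP; lra.
  have i1 (a b : R) : \1_[set a] b = (b == a)%:R :> R.
    rewrite indicE; congr ((nat_of_bool _)%:R); apply/idP/eqP => [|->]; by rewrite inE.
  rewrite -[X in sign_measure X = _]/(sign_rv i @^-1` [set 1]).
  rewrite -[X in _ /\ sign_measure X = _]/(sign_rv i @^-1` [set -1]).
  rewrite !sign_marginal !big_bool/= expr1 expr0 !i1.
  by rewrite [-1 == 1]eq_sym n1 !eqxx/= addr0 add0r mulr1.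
- apply: etrans (sign_cylinder J A) _; rewrite -prodEFin; apply: eq_bigr => i _.
  exact/esym/sign_marginal.
Qed.

Lemma Lq_norm_signs (F : normedModType R) (q : R) (x : 'I_M -> F) :
  Lq_norm sign_measure q (fun n => \sum_(j < M) sign_rv j n *: x j) =
  (((2 ^+ M)^-1 * \sum_(e : signs) `|\sum_j (-1) ^+ e j *: x j| `^ q) `^ q^-1)%:E.
Proof.
rewrite /Lq_norm unlock -poweR_EFin.
rewrite -(@integral_signs (fun e => `|\sum_j (-1) ^+ e j *: x j| `^ q)); last first.
  by move=> e; exact: powR_ge0.
congr (poweR _ _); apply: eq_integral => n _.
by rewrite -poweR_EFin /= normr_id.
Qed.

End SignSpace.

(** * Consequences of the constants for sums over signs *)

Section Constants.
Context (R : realType).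

(** Passes from all admissible constants to their infimum without attainment. For b > 0 one divides
    by b; for b = 0 one admissible constant suffices, and it exists because the infimum is
    finite. *)
Lemma ereal_inf_mul_le (S : set R) (a b c : R) : 0 <= b ->
  (forall K, S K -> 0 < K /\ a <= K * b) ->
  ereal_inf [set K%:E | K in S] = c%:E -> a <= c * b.
Proof.
move=> b0 SP infc.
have [K SK] : S !=set0.
  apply/set0P/eqP => S0; move: infc; rewrite S0 image_set0 ereal_inf0.
  by [].
move: b0; rewrite le_eqVlt => /predU1P[b0|b0].
  by have [_] := SP K SK; rewrite -b0 !mulr0.
rewrite -ler_pdivrMr// -lee_fin -infc; apply: le_ereal_inf_tmp => _ [K' SK' <-].
by rewrite lee_fin ler_pdivrMr//; have [] := SP K' SK'.
Qed.

Context (E : completeNormedModType R) (p q : R) (p_gt0 : 0 < p) (q_gt0 : 0 < q).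

Definition sign_moment (M : nat) (r : R) (x : 'I_M -> E) : R :=
  ((2 ^+ M)^-1 * \sum_(e : {ffun 'I_M -> bool}) `|\sum_j (-1) ^+ e j *: x j| `^ r) `^ r^-1.

Lemma kahane_khintchine_sign (c : R) (M : nat) (x : 'I_M -> E) :
  kahane_khintchine q p = c%:E -> sign_moment q x <= c * sign_moment p x.
Proof.
apply: ereal_inf_mul_le; first exact: powR_ge0.
move=> K [K0 hK]; split => //.
have := hK _ _ _ _ _ E x (@sign_measure_complete R M) (@sign_rv_rademacher R M).
by rewrite !Lq_norm_signs -EFinM lee_fin.
Qed.

Lemma type_constant_sign (c : R) (M : nat) (x : 'I_M -> E) :
  type_constant E p = c%:E -> sign_moment p x <= c * (\sum_j `|x j| `^ p) `^ p^-1.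
Proof.
apply: ereal_inf_mul_le; first exact: powR_ge0.
move=> K [K0 hK]; split => //.
have := hK _ _ _ _ _ x (@sign_measure_complete R M) (@sign_rv_rademacher R M).
by rewrite !Lq_norm_signs lee_fin.
Qed.

Lemma rademacher_bound_constants (c t : R) (M : nat) :
  kahane_khintchine q p = c%:E -> type_constant E p = t%:E -> 0 <= c -> 0 <= t ->
  rademacher_bound E p q M (c * t).
Proof.
move=> hc ht c0 t0 x; set Z := (\sum_j _) `^ p^-1.
have h : sign_moment q x <= c * t * Z.
  apply: le_trans (kahane_khintchine_sign x hc) _.
  by rewrite -mulrA ler_wpM2l// type_constant_sign.
have Z0 : 0 <= c * t * Z by rewrite !mulr_ge0 ?powR_ge0.
rewrite -ler_pdivrMl ?exprn_gt0//.
have : sign_moment q x `^ q <= (c * t * Z) `^ q.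
  by rewrite ge0_ler_powR ?nnegrE ?powR_ge0 ?(ltW q_gt0).
apply: le_trans; rewrite /sign_moment -powRrM mulVf ?gt_eqF// powRr1//.
by rewrite mulr_ge0 ?invr_ge0 ?exprn_ge0// sumr_ge0// => e _; exact: powR_ge0.
Qed.

(** A Rademacher sum with the single term v has norm |v|, which excludes the constant 0. This
    prevents a product of an infinite Kahane-Khintchine constant with 0. *)
Lemma type_constant_gt0 (v : E) : v != 0 -> (0 < type_constant E p)%E.
Proof.
move=> v0; rewrite lt_neqAle; apply/andP; split; last first.
  by apply: le_ereal_inf_tmp => _ [K [K0 _] <-]; rewrite lee_fin ltW.
apply/eqP => /esym t0; have := type_constant_sign (fun _ : 'I_1 => v) t0.
rewrite mul0r le_eqVlt ltNge powR_ge0 orbF => /eqP /powR_eq0_eq0 /eqP.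
rewrite mulf_eq0 invr_eq0 expf_eq0 pnatr_eq0/= => /eqP s0.
have /(_ [ffun=> false] isT)/powR_eq0_eq0/eqP := psumr_eq0P (fun e _ => powR_ge0 _ _) s0.
by rewrite big_ord1 ffunE expr0 scale1r normr_eq0 (negPf v0).
Qed.

(** The triangle inequality, each |x_j| being at most the l_p norm. A finite constant, however
    crude, settles the case in which the moment of the sample vanishes. *)
Lemma rademacher_bound_trivial (M : nat) : rademacher_bound E p q M M%:R.
Proof.
move=> x; set Z := (\sum_j _) `^ p^-1.
have xZ j : `|x j| <= Z.
  have -> : `|x j| = (`|x j| `^ p) `^ p^-1 by rewrite -powRrM divff ?gt_eqF// powRr1.
  have S0 : 0 <= \sum_(i | i != j) `|x i| `^ p by apply: sumr_ge0 => i _; exact: powR_ge0.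
  rewrite ge0_ler_powR ?nnegrE ?powR_ge0 ?invr_ge0 ?(ltW p_gt0)//.
    by rewrite (bigD1 j)//= addr_ge0 ?powR_ge0.
  by rewrite (bigD1 j)//= lerDl.
have -> : 2 ^+ M * (M%:R * Z) `^ q = \sum_(e : {ffun 'I_M -> bool}) (M%:R * Z) `^ q.
  by rewrite sumr_const card_ffun card_bool card_ord -natrX mulr_natl.
apply: ler_sum => e _; rewrite ge0_ler_powR ?nnegrE ?mulr_ge0 ?powR_ge0 ?(ltW q_gt0)//.
apply: (le_trans (ler_norm_sum _ _ _)).
apply: le_trans (_ : \sum_(j < M) Z <= _).
  by apply: ler_sum => j _; rewrite normrZ normr_sign mul1r.
by rewrite sumr_const card_ord mulr_natl.
Qed.

End Constants.

(** * Distance of moments *)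

Lemma prod_le_mean_exp (R : realType) (k : nat) (x : 'I_k -> R) : (0 < k)%N ->
  (forall j, 0 <= x j) -> \prod_j x j <= k%:R^-1 * \sum_j x j ^+ k.
Proof.
move=> k0 x0; have S0 : 0 <= k%:R^-1 * \sum_j x j ^+ k.
  by rewrite mulr_ge0 ?invr_ge0// sumr_ge0// => j _; rewrite exprn_ge0.
rewrite -(ler_pXn2r k0) ?nnegrE ?prodr_ge0// -prodrXl mulrC.
have [+ _] := @leif_AGM R 'I_k predT (fun j => x j ^+ k) (fun j _ => exprn_ge0 k (x0 j)).
rewrite card_ord; under eq_bigl do rewrite inE.
by under [in leRHS]eq_bigl do rewrite inE.
Qed.

Section Hoelder.
Context (R : realType) (d : measure_display) (Omega : measurableType d).
Context (P : probability Omega R) (k : nat) (k_gt0 : (0 < k)%N).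
Context (h : 'I_k -> Omega -> R) (H : 'I_k -> R).
Hypotheses (mh : forall j, measurable_fun setT (h j)) (h0 : forall j w, 0 <= h j w).
Hypotheses (H0 : forall j, 0 <= H j).
Hypothesis hH : forall j, (\int[P]_w (h j w ^+ k)%:E <= (H j ^+ k)%:E)%E.

(* AM-GM for the normalized factors [h j / A j]; the slack in [H j < A j] avoids
   dividing by a vanishing norm. *)
Lemma integral_prod_lt (A : 'I_k -> R) : (forall j, H j < A j) ->
  (\int[P]_w (\prod_j h j w)%:E <= (\prod_j A j)%:E)%E.
Proof.
move=> HA; have A0 j : 0 < A j by exact: le_lt_trans (HA j).
(* The coefficient of h_j^k after the arithmetic-geometric mean inequality for the h_j / A_j,
   multiplied by the product of the A_i. *)
pose c j := (\prod_i A i) * (k%:R^-1 / A j ^+ k).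
have PA0 : 0 <= \prod_i A i by apply: prodr_ge0 => i _; exact: ltW.
have c0 j : 0 <= c j by rewrite mulr_ge0// mulr_ge0 ?invr_ge0// exprn_ge0// ltW.
have mhk j : measurable_fun setT (fun w => h j w ^+ k) by exact: measurable_funX.
apply: le_trans (_ : \int[P]_w (\sum_j (c j)%:E * (h j w ^+ k)%:E) <= _)%E.
  apply: ge0_le_integral => //.
  - by move=> w _; rewrite lee_fin prodr_ge0.
  - apply/measurable_EFinP; exact: measurable_prod.
  - by apply: emeasurable_sum => j; apply: measurable_funeM; exact/measurable_EFinP.
  - move=> w _; rewrite (eq_bigr (fun j => (c j * h j w ^+ k)%:E))// sumEFin lee_fin.
    have -> : \prod_j h j w = \prod_j A j * \prod_j (h j w / A j).
      by rewrite -big_split/=; apply: eq_bigr => j _; rewrite mulrC divfK// gt_eqF.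
    apply: le_trans (_ : \prod_j A j * (k%:R^-1 * \sum_j (h j w / A j) ^+ k) <= _).
      by rewrite ler_wpM2l// prod_le_mean_exp// => j; rewrite divr_ge0// ltW.
    rewrite !mulr_sumr; apply: ler_sum => j _; rewrite /c exprMn exprVn.
    by apply: eq_ler; ring.
rewrite ge0_integral_sum//; last 2 first.
- by move=> j; apply: measurable_funeM; exact/measurable_EFinP.
- by move=> j w _; rewrite mule_ge0 ?lee_fin ?exprn_ge0.
apply: le_trans (_ : \sum_j (c j)%:E * (A j ^+ k)%:E <= _)%E.
  apply: lee_sum => j _; rewrite ge0_integralZl_EFin//.
  - rewrite lee_wpmul2l ?lee_fin//; apply: (le_trans (hH j)).
    by rewrite lee_fin lerXn2r ?nnegrE ?(ltW (HA j))// ltW.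
  - by move=> w _; rewrite lee_fin exprn_ge0.
  - exact/measurable_EFinP.
rewrite (eq_bigr (fun j => (c j * A j ^+ k)%:E))// sumEFin lee_fin.
have -> : \sum_j c j * A j ^+ k = \sum_(j < k) (\prod_i A i) * k%:R^-1.
  by apply: eq_bigr => j _; rewrite /c -mulrA divfK// expf_neq0// gt_eqF.
rewrite sumr_const card_ord -(mulr_natr (_ * _)) -mulrA mulVf ?mulr1//.
by rewrite pnatr_eq0 -lt0n.
Qed.

Lemma integral_prod_le : (\int[P]_w (\prod_j h j w)%:E <= (\prod_j H j)%:E)%E.
Proof.
have c : (\prod_j (H j + n.+1%:R^-1))%:E @[n --> \oo] --> (\prod_j H j)%:E.
  apply: cvg_EFinW; apply: (cvg_big mul_continuous) => j _.
  rewrite -[X in _ --> X]addr0; apply: cvgD; first exact: cvg_cst.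
  exact: cvg_harmonic.
apply: (cvge_le_cvg (cvg_cst _) c) => n; apply: integral_prod_lt => j.
by rewrite ltrDl invr_gt0.
Qed.

End Hoelder.

(** Writes a b^i c^(m-i) as a product of m + 1 factors, so that every term of [power_gap] falls
    under the Hoelder inequality for k functions with equal exponents. *)
Lemma prod_three (R : realType) (m i : nat) (a b c : R) : (i <= m)%N ->
  \prod_(j < m.+1) (if (j < i)%N then b else if (j < m)%N then c else a) =
  a * (b ^+ i * c ^+ (m - i)).
Proof.
move=> im.
rewrite -(big_mkord xpredT (fun j => if (j < i)%N then b else if (j < m)%N then c else a)).
rewrite big_nat_recr//= ltnn ltnNge im/= mulrC; congr (_ * _).
rewrite (big_cat_nat (leq0n i) im)/=; congr (_ * _).
  rewrite (eq_big_nat _ _ (F2 := fun=> b)) ?prodr_const_nat ?subn0//.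
  by move=> j /andP[_ ->].
rewrite (eq_big_nat _ _ (F2 := fun=> c)) ?prodr_const_nat//.
by move=> j /andP[ij ->]; rewrite ltnNge ij.
Qed.

Section MomentDistance.
Context (R : realType) (d : measure_display) (Omega : measurableType d).
Context (P : probability Omega R) (cP : measure_is_complete P).
Context (E : normedModType R) (k : nat) (k_gt0 : (0 < k)%N).
Context (X Y : Omega -> E) (bX : bochner_measurable P X) (bY : bochner_measurable P Y).
Local Notation tau := (@sym_tensor_pow R k E).

(** The moment in the symmetric completion is defined through the injective one and not as an
    integral there, so the estimate is made for discretizations of X and Y with common points and
    passed to the limit. *)
Lemma sym_inj_moment_dist :
  (\int[P]_w (`|X w| ^+ k)%:E < +oo)%E -> (\int[P]_w (`|Y w| ^+ k)%:E < +oo)%E ->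
  (`|sym_inj_moment P k X - sym_inj_moment P k Y|%:E <=
   \int[P]_w `|tau (X w) - tau (Y w)|%:E)%E.
Proof.
move=> iX iY; have bXY (b : bool) : bochner_measurable P (if b then X else Y) by case: b.
have [y [y0 ay]] := bochner_adherent bXY.
have aX : {ae P, forall w, adherent y (X w)} by apply: filterS ay => w /(_ true).
have aY : {ae P, forall w, adherent y (Y w)} by apply: filterS ay => w /(_ false).
have tl := @sym_tensor_pow_lipschitz R E k.
have LX := discretization_L1 cP y0 bX aX k_gt0 iX tl.
have LY := discretization_L1 cP y0 bY aY k_gt0 iY tl.
have btX : bochner_measurable P (tau \o X) by exact: (tau_bochner bX tl).
have btY : bochner_measurable P (tau \o Y) by exact: (tau_bochner bY tl).
have sX n : simple_rv (discretization y X tau n) by apply: (discretization_simple cP).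
have sY n : simple_rv (discretization y Y tau n) by apply: (discretization_simple cP).
have bsX n := simple_rv_bochner P (sX n); have bsY n := simple_rv_bochner P (sY n).
have c1 : `|simple_expectation P (discretization y X tau n) -
    simple_expectation P (discretization y Y tau n)|%:E @[n --> \oo] -->
    `|sym_inj_moment P k X - sym_inj_moment P k Y|%:E.
  apply: cvg_EFinW; apply: cvg_norm; apply: cvgB.
    by under eq_fun do rewrite sym_moment_approxE//; exact: sym_inj_moment_cvg.
  by under eq_fun do rewrite sym_moment_approxE//; exact: sym_inj_moment_cvg.
pose T := (\int[P]_w `|tau (X w) - tau (Y w)|%:E)%E.
have T0 : (0 <= T)%E by apply: integral_ge0 => w _; rewrite lee_fin.
have c2 : ((\int[P]_w `|tau (X w) - discretization y X tau n w|%:E) +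
    (T + \int[P]_w `|tau (Y w) - discretization y Y tau n w|%:E))%E @[n --> \oo] --> T.
  rewrite -[X in _ --> X]add0e -[X in _ --> (0 + X)%E]adde0.
  apply: (cvgeD _ LX); first by rewrite ge0_adde_def ?inE// adde0.
  by apply: (cvgeD _ (cvg_cst T) LY); rewrite ge0_adde_def ?inE.
apply: (cvge_le_cvg c1 c2) => n.
apply: (le_trans (simple_expectation_dist P (sX n) (sY n))).
have tri1 := bochner_dist_triangle cP (bsX n) btX (bsY n).
have tri2 := bochner_dist_triangle cP btX btY (bsY n).
rewrite [X in (_ <= X + _)%E]bochner_distC in tri1.
apply: (le_trans tri1); apply: leeD; first exact: lexx.
exact: tri2.
Qed.

Lemma sym_tensor_dist_integral (A B C : R) : 0 <= A -> 0 <= B -> 0 <= C ->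
  (\int[P]_w (`|X w - Y w| ^+ k)%:E <= (A ^+ k)%:E)%E ->
  (\int[P]_w (`|X w| ^+ k)%:E <= (B ^+ k)%:E)%E ->
  (\int[P]_w (`|Y w| ^+ k)%:E <= (C ^+ k)%:E)%E ->
  (\int[P]_w `|tau (X w) - tau (Y w)|%:E <= (A * power_gap k B C)%:E)%E.
Proof.
move=> A0 B0 C0 hA hB hC.
have mD := bochner_dist_measurable cP bX bY.
have mX := bochner_norm_measurable cP bX; have mY := bochner_norm_measurable cP bY.
pose sel i (j : 'I_k) (T : Type) (a b c : T) : T :=
  if (j < i)%N then b else if (j < k.-1)%N then c else a.
have selE (i : 'I_k) (a b c : R) : \prod_j sel i j _ a b c = a * (b ^+ i * c ^+ (k - i - 1)).
  have := @prod_three R k.-1 i a b c; rewrite prednK// -subn1 subnAC subn1 => ->//.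
  by have := ltn_ord i; lia.
have term (i : 'I_k) :
    (\int[P]_w (`|X w - Y w| * (`|X w| ^+ i * `|Y w| ^+ (k - i - 1)))%:E <=
     (A * (B ^+ i * C ^+ (k - i - 1)))%:E)%E.
  rewrite -selE.
  under eq_integral do rewrite -selE.
  apply: (@integral_prod_le R d Omega P k k_gt0
    (fun j w => sel i j _ `|X w - Y w| `|X w| `|Y w|) (fun j => sel i j _ A B C)) => // j;
    by rewrite /sel; case: (j < i)%N => //; case: (j < k.-1)%N.
apply: le_trans (_ : \int[P]_w (\sum_(i < k)
    (`|X w - Y w| * (`|X w| ^+ i * `|Y w| ^+ (k - i - 1)))%:E) <= _)%E.
  apply: ge0_le_integral => //.
  - apply/measurable_EFinP; apply: (bochner_dist_measurable cP).
      exact: (tau_bochner bX (@sym_tensor_pow_lipschitz R E k)).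
    exact: (tau_bochner bY (@sym_tensor_pow_lipschitz R E k)).
  - apply: emeasurable_sum => i; apply/measurable_EFinP.
    do 2 (apply: measurable_realfun.measurable_funM => //); exact: measurable_funX.
  - by move=> w _; rewrite sumEFin lee_fin -mulr_sumr; exact: sym_tensor_pow_lipschitz.
rewrite ge0_integral_sum//.
- by rewrite mulr_sumr -sumEFin; apply: lee_sum.
- move=> i; apply/measurable_EFinP.
  do 2 (apply: measurable_realfun.measurable_funM => //); exact: measurable_funX.
Qed.

End MomentDistance.

(** * Moments and L_q norms *)

Section LqNorms.
Context (R : realType) (d : measure_display) (Omega : measurableType d).
Context (P : probability Omega R).
Local Open Scope ereal_scope.

Lemma Lq_normE (F : normedModType R) (q : R) (f : Omega -> F) :
  Lq_norm P q f = (\int[P]_w (`|f w| `^ q)%:E) `^ q^-1.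
Proof.
rewrite /Lq_norm unlock; congr (poweR _ _); apply: eq_integral => w _.
by rewrite -poweR_EFin /= normr_id.
Qed.

Lemma Lq_norm_lty (F : normedModType R) (q : R) (f : Omega -> F) : (0 < q)%R ->
  Lq_norm P q f < +oo -> \int[P]_w (`|f w| `^ q)%:E < +oo.
Proof. by move=> q0; rewrite Lq_normE; apply: lty_poweRy; rewrite invr_neq0// gt_eqF. Qed.

(** Minkowski with a constant function, whose L_q norm under a probability is the constant
    itself. *)
Lemma Lq_norm_le_add (F G : normedModType R) (q a : R) (f : Omega -> F) (g : Omega -> G) :
  (1 <= q)%R -> (0 <= a)%R -> (forall w, `|f w| <= a + `|g w|)%R ->
  measurable_fun setT (fun w => `|f w|%R) -> measurable_fun setT (fun w => `|g w|%R) ->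
  Lq_norm P q f <= a%:E + Lq_norm P q g.
Proof.
move=> q1 a0 fg mf mg; have q0 : (0 < q)%R by exact: lt_le_trans q1.
have mq (h : Omega -> R) : measurable_fun setT h -> measurable_fun setT (fun w => h w `^ q)%R.
  by move=> mh; exact: (measurableT_comp (measurable_powR q) mh).
have ma : measurable_fun setT (fun w => a + `|g w|)%R by exact: measurable_funD.
have := @minkowski_EFin _ _ _ P (fun=> a) (fun w => `|g w|%R) q (measurable_cst _) mg q1.
rewrite unlock -!/(_ \+ _) => mink.
have -> : a%:E + Lq_norm P q g =
    (\int[P]_w `|a%:E| `^ q) `^ q^-1 + (\int[P]_w `|(`|g w|%:E)| `^ q) `^ q^-1.
  congr (_ + _); last first.
    rewrite Lq_normE; congr (poweR _ _); apply: eq_integral => w _.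
    by rewrite -poweR_EFin /= normr_id.
  rewrite integral_cst//.
  have -> : (P : {measure set Omega -> \bar R}) setT = 1 by exact: probability_setT.
  by rewrite mule1 poweR_EFin -powRrM mulfV ?gt_eqF// powRr1 ?ger0_norm.
apply: le_trans mink.
rewrite [leRHS](_ : _ = (\int[P]_w ((a + `|g w|) `^ q)%:E) `^ q^-1); last first.
  congr (poweR _ _); apply: eq_integral => w _.
  by rewrite -poweR_EFin /= ger0_norm ?addr_ge0.
rewrite Lq_normE; apply: gt0_ler_poweR.
- by rewrite invr_ge0 ltW.
- by rewrite in_itv/= leey andbT; apply: integral_ge0 => w _; rewrite lee_fin powR_ge0.
- by rewrite in_itv/= leey andbT; apply: integral_ge0 => w _; rewrite lee_fin powR_ge0.
apply: ge0_le_integral => //.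
- by apply/measurable_EFinP; exact: mq.
- by apply/measurable_EFinP; exact: mq.
- by move=> w _; rewrite lee_fin ge0_ler_powR ?nnegrE ?addr_ge0 ?(ltW q0).
Qed.

Context (E : normedModType R) (k : nat) (k_gt0 : (0 < k)%N).

Lemma integral_powR_exp (X : Omega -> E) :
  \int[P]_w (`|X w| `^ k%:R)%:E = \int[P]_w (`|X w| ^+ k)%:E.
Proof. by apply: eq_integral => w _; rewrite powR_mulrn. Qed.

Lemma integral_powR_mul (X : Omega -> E) (q : R) :
  \int[P]_w (`|X w| `^ (k%:R * q))%:E = \int[P]_w ((`|X w| ^+ k) `^ q)%:E.
Proof. by apply: eq_integral => w _; rewrite powRrM powR_mulrn. Qed.

Lemma integral_fineK (h : Omega -> R) : (forall w, 0 <= h w)%R ->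
  \int[P]_w (h w)%:E < +oo -> (fine (\int[P]_w (h w)%:E))%:E = \int[P]_w (h w)%:E.
Proof.
move=> h0 hoo; rewrite fineK// ge0_fin_numE//.
by apply: integral_ge0 => w _; rewrite lee_fin.
Qed.

Lemma Lq_norm_expn (X : Omega -> E) (q : R) : (0 < q)%R ->
  \int[P]_w ((`|X w| ^+ k) `^ q)%:E < +oo ->
  Lq_norm P (k%:R * q) X ^+ k = (fine (\int[P]_w ((`|X w| ^+ k) `^ q)%:E) `^ q^-1)%:E.
Proof.
move=> q0 iX; have k0 : (k%:R != 0 :> R)%R by rewrite pnatr_eq0 -lt0n.
have := integral_fineK (fun w => powR_ge0 (`|X w| ^+ k) q) iX.
rewrite Lq_normE integral_powR_mul; set I := fine _ => <-.
rewrite poweR_EFin -EFin_expe; congr (_%:E).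
by rewrite -powR_mulrn ?powR_ge0// -powRrM invfM mulrAC mulVf// mul1r.
Qed.

Lemma Lq_norm_nat (X : Omega -> E) : \int[P]_w (`|X w| ^+ k)%:E < +oo ->
  exists2 A : R, (0 <= A)%R &
    Lq_norm P k%:R X = A%:E /\ \int[P]_w (`|X w| ^+ k)%:E = (A ^+ k)%:E.
Proof.
move=> iX; have k0 : (k%:R != 0 :> R)%R by rewrite pnatr_eq0 -lt0n.
have I0 : (0 <= fine (\int[P]_w (`|X w| ^+ k)%:E))%R.
  by rewrite fine_ge0//; apply: integral_ge0 => w _; rewrite lee_fin exprn_ge0.
have := integral_fineK (fun w => exprn_ge0 k (normr_ge0 (X w))) iX.
rewrite Lq_normE integral_powR_exp; set I := fine _ in I0 * => <-.
exists (I `^ k%:R^-1)%R; first exact: powR_ge0.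
split; first by rewrite poweR_EFin.
by rewrite -powR_mulrn ?powR_ge0// -powRrM mulVf// powRr1.
Qed.

Hypothesis cP : measure_is_complete P.

(** Integrates t <= 1 + t^q for t >= 0 and q >= 1, the measure being finite. *)
Lemma integral_exp_lty (X : Omega -> E) (q : R) : bochner_measurable P X -> (1 <= q)%R ->
  \int[P]_w ((`|X w| ^+ k) `^ q)%:E < +oo -> \int[P]_w (`|X w| ^+ k)%:E < +oo.
Proof.
move=> bX q1 iX.
have mX : measurable_fun setT (fun w => `|X w| ^+ k)%R.
  by apply: measurable_funX; exact: (bochner_norm_measurable cP bX).
have mq : measurable_fun setT (fun w => (`|X w| ^+ k) `^ q)%R.
  exact: (measurableT_comp (measurable_powR q) mX).
have tri : \int[P]_w (`|X w| ^+ k)%:E <=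
    \int[P]_w 1%:E + \int[P]_w ((`|X w| ^+ k) `^ q)%:E.
  apply: (@integral_triangle _ _ _ P _ (fun=> 1%R)) => //.
  move=> w; have [t1|t1] := leP (`|X w| ^+ k)%R 1%R.
      by rewrite (le_trans t1)// lerDl powR_ge0.
    by rewrite (le_trans (le1r_powR (ltW t1) q1))// lerDr.
apply: (le_lt_trans tri).
rewrite integral_cst// mul1e.
have -> : (P : {measure set Omega -> \bar R}) setT = 1 by exact: probability_setT.
by rewrite lte_add_pinfty// ltry.
Qed.

(** From |X - Y| <= 2 max(|X|, |Y|), and the k-th power of the maximum is at most the sum of the
    k-th powers. *)
Lemma integral_dist_lty (X Y : Omega -> E) : bochner_measurable P X -> bochner_measurable P Y ->
  \int[P]_w (`|X w| ^+ k)%:E < +oo -> \int[P]_w (`|Y w| ^+ k)%:E < +oo ->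
  \int[P]_w (`|X w - Y w| ^+ k)%:E < +oo.
Proof.
move=> bX bY iX iY; have c0 : (0 <= 2 ^+ k :> R)%R by rewrite exprn_ge0.
have mX := bochner_norm_measurable cP bX; have mY := bochner_norm_measurable cP bY.
have mD := bochner_dist_measurable cP bX bY.
have mc (h : Omega -> R) : measurable_fun setT h ->
    measurable_fun setT (fun w => 2 ^+ k * h w ^+ k)%R.
  by move=> mh; apply: measurable_realfun.measurable_funM => //; exact: measurable_funX.
have lt (h : Omega -> R) : measurable_fun setT h -> (forall w, 0 <= h w)%R ->
    \int[P]_w (h w ^+ k)%:E < +oo -> \int[P]_w (2 ^+ k * h w ^+ k)%:E < +oo.
  move=> mh h0 ih; under eq_integral do rewrite EFinM.
  rewrite ge0_integralZl_EFin//.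
  - exact: lte_mul_pinfty.
  - by move=> w _; rewrite lee_fin exprn_ge0.
  - by apply/measurable_EFinP; exact: measurable_funX.
have tri : \int[P]_w (`|X w - Y w| ^+ k)%:E <=
    \int[P]_w (2 ^+ k * `|X w| ^+ k)%:E + \int[P]_w (2 ^+ k * `|Y w| ^+ k)%:E.
  apply: integral_triangle; [exact: measurable_funX|exact: mc|exact: mc| | | |].
  - by move=> w; rewrite exprn_ge0.
  - by move=> w; rewrite mulr_ge0 ?exprn_ge0.
  - by move=> w; rewrite mulr_ge0 ?exprn_ge0.
  - move=> w; have h : (`|X w - Y w| <= 2 * Num.max `|X w| `|Y w|)%R.
      apply: (le_trans (ler_normB _ _)).
      by rewrite mulr2n mulrDl mul1r lerD// le_max lexx ?orbT.
    apply: le_trans (lerXn2r k _ _ h) _; [by rewrite nnegrE|by rewrite nnegrE (le_trans _ h)|].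
    rewrite exprMn -mulrDr; apply: ler_wpM2l => //.
    have [_|_] := lerP `|X w| `|Y w|; first by rewrite lerDr exprn_ge0.
    by rewrite lerDl exprn_ge0.
apply: (le_lt_trans tri).
by apply: lte_add_pinfty; apply: lt.
Qed.

End LqNorms.

(** * The rate *)

Section Rate.
Context (R : realType) (d : measure_display) (Omega : measurableType d).
Context (P : probability Omega R) (cP : measure_is_complete P).
Context (E : completeNormedModType R) (p q B : R) (k M : nat).
Context (k_gt0 : (0 < k)%N) (M_gt0 : (0 < M)%N).
Context (p_ge1 : 1 <= p) (pq : p <= q) (tE : rademacher_type E p) (B_gt0 : 0 < B).
Context (xi : 'I_M -> Omega -> E) (j1 : 'I_M).
Hypothesis hxi : forall j, in_Lq P (k%:R * q) (xi j).
Hypotheses (indep : independent_rvs P xi) (ident : identically_distributed P xi).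

Let p_gt0 : 0 < p. Proof. exact: lt_le_trans p_ge1. Qed.
Let q_ge1 : 1 <= q. Proof. exact: le_trans pq. Qed.
Let q_gt0 : 0 < q. Proof. exact: lt_le_trans q_ge1. Qed.

Let ixiq j : (\int[P]_w ((`|xi j w| ^+ k) `^ q)%:E < +oo)%E.
Proof.
have [_] := hxi j; move/Lq_norm_lty; rewrite integral_powR_mul; apply.
by rewrite mulr_gt0// ltr0n.
Qed.

Let bxi j : bochner_measurable P (xi j). Proof. by have [] := hxi j. Qed.

Lemma Lq_norm_exp_integrable j : (\int[P]_w (`|xi j w| ^+ k)%:E < +oo)%E.
Proof. exact: (integral_exp_lty cP (bxi j) q_ge1 (ixiq j)). Qed.

Local Notation rate := (M%:R `^ (- (1 - p^-1))).

Lemma monte_carlo_Lq_norm (K : R) : 0 <= K -> rademacher_bound E p q M K ->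
  (Lq_norm P q (monte_carlo_error P k xi j1) <=
   (4 * k%:R * K * rate)%:E * Lq_norm P (k%:R * q) (xi j1) ^+ k)%E.
Proof.
move=> K0 hK; set c := 4 * k%:R * K * rate.
have c0 : 0 <= c by rewrite !mulr_ge0 ?powR_ge0.
have := monte_carlo_moment cP k_gt0 M_gt0 p_ge1 pq K0 hK bxi (Lq_norm_exp_integrable j1)
  (ixiq j1) indep ident.
rewrite Lq_norm_expn//; have := integral_fineK (fun w => powR_ge0 (`|xi j1 w| ^+ k) q) (ixiq j1).
have : 0 <= fine (\int[P]_w ((`|xi j1 w| ^+ k) `^ q)%:E).
  by rewrite fine_ge0//; apply: integral_ge0 => w _; rewrite lee_fin powR_ge0.
set I := fine _ => I0 <-; rewrite -EFinM => h; rewrite Lq_normE.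
apply: le_trans (_ : ((c `^ q * I)%:E `^ q^-1) <= _)%E.
  apply: gt0_ler_poweR => //; first by rewrite invr_ge0 ltW.
    by rewrite in_itv/= leey andbT; apply: integral_ge0 => w _; rewrite lee_fin powR_ge0.
  by rewrite in_itv/= leey andbT lee_fin mulr_ge0 ?powR_ge0.
rewrite poweR_EFin -EFinM lee_fin powRM ?powR_ge0//.
by rewrite -powRrM mulfV ?gt_eqF// powRr1.
Qed.

(** Finiteness of the Kahane-Khintchine constant is not among the hypotheses, so infinite values are
    treated: the right-hand side is then +oo unless a factor 0 intervenes, and the two sources of
    such a factor are separated first. *)
Lemma SL_constant_rate :
  (Lq_norm P q (monte_carlo_error P k xi j1) <=
   SL_constant E B q p k * rate%:E * Lq_norm P (k%:R * q) (xi j1) ^+ k)%E.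
Proof.
have k0 : 0 < k%:R :> R by rewrite ltr0n.
have rate0 : 0 < rate by rewrite powR_gt0// ltr0n.
have [t t0 ht] := tE.
have T0 : (0 <= type_constant E p)%E.
  by apply: le_ereal_inf_tmp => _ [K [K0 _] <-]; rewrite lee_fin ltW.
have KK0 : (0 <= kahane_khintchine q p)%E.
  by apply: le_ereal_inf_tmp => _ [K [K0 _] <-]; rewrite lee_fin ltW.
have Tfin : type_constant E p \is a fin_num.
  rewrite ge0_fin_numE//; apply: le_lt_trans (ltry t).
  by apply: ereal_inf_lbound; exists t.
have TE := fineK Tfin; set T := fine _ in TE.
have T0' : 0 <= T by rewrite fine_ge0.
have mid0 : (0 <= (2 * k%:R)%:E * kahane_khintchine q p * type_constant E p)%E.
  by rewrite !mule_ge0// lee_fin mulr_ge0// ltW.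
have C0 : (0 <= SL_constant E B q p k)%E.
  by rewrite mule_ge0 ?lee_fin// adde_ge0// lee_fin ltW.
have L0 : (0 <= Lq_norm P (k%:R * q) (xi j1))%E by exact: Lnorm_ge0.
have Lfin := Lq_norm_expn k_gt0 q_gt0 (ixiq j1).
set L := Lq_norm _ _ _ in L0 Lfin *.
(* Here the right-hand side is 0 even for an infinite constant, and the fallback bound with the
   finite constant M shows that the error vanishes too. *)
have [Lk0|Lk0] := eqVneq (L ^+ k)%E 0%E.
  rewrite Lk0 mule0.
  have triv := @rademacher_bound_trivial R E p q p_gt0 q_gt0 M.
  have := monte_carlo_Lq_norm (ler0n _ M) triv.
  by rewrite -/L Lk0 mule0.
have Lk : (0 < L ^+ k)%E by rewrite lt_neqAle eq_sym Lk0 Lfin lee_fin powR_ge0.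
(* If E were zero, so would be the moment of the sample; a nonzero vector makes the type constant
   positive. *)
have [v v0] : exists v : E, v != 0.
  apply: contrapT => /forallNP v0; move/eqP: Lk0; apply; rewrite Lfin.
  have -> : (\int[P]_w ((`|xi j1 w| ^+ k) `^ q)%:E = 0)%E.
    rewrite -[RHS](integral0 P setT); apply: eq_integral => w _.
    have /negP/negPn/eqP -> := v0 (xi j1 w).
    by rewrite normr0 expr0n gtn_eqF// powR0// gt_eqF.
  by rewrite powR0// invr_neq0// gt_eqF.
have T_gt0 := type_constant_gt0 p v0.
have [KKfin|KKinf] := boolP (kahane_khintchine q p \is a fin_num); last first.
  have KKy : kahane_khintchine q p = +oo%E.
    by move: KKinf; rewrite ge0_fin_numE// -leNgt leye_eq => /eqP.
  have -> : SL_constant E B q p k = +oo%E.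
    rewrite /SL_constant KKy gt0_muley ?lte_fin ?mulr_gt0// gt0_mulye//.
    by rewrite addye// gt0_muley// lte_fin.
  rewrite gt0_mulye ?lte_fin//.
  by rewrite gt0_mulye// leey.
have KKE := fineK KKfin; set KK := fine _ in KKE.
have KK0' : 0 <= KK by rewrite fine_ge0.
have := monte_carlo_Lq_norm (mulr_ge0 KK0' T0')
  (rademacher_bound_constants (M := M) q_gt0 (esym KKE) (esym TE) KK0' T0').
move=> /le_trans; apply; rewrite -/L; apply: lee_wpmul2r; first exact: ltW.
have -> : SL_constant E B q p k = (2 * (2 * k%:R * KK * T + B))%:E.
  by rewrite /SL_constant -KKE -TE [RHS]EFinM (EFinD _ B) (EFinM _ T) (EFinM _ KK).
rewrite -EFinM lee_fin ler_wpM2r ?(ltW rate0)//.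
have -> : 2 * (2 * k%:R * KK * T + B) = 4 * k%:R * (KK * T) + 2 * B by ring.
by rewrite lerDl mulr_ge0// ltW.
Qed.

Lemma SL_rate (U : sym_inj_tensor_power k E) :
  (Lq_norm P q (fun w => (U - M%:R^-1 *: \sum_(j < M) sym_tensor_pow k (xi j w))%R)
   <= `|U - sym_inj_moment P k (xi j1)|%:E
      + SL_constant E B q p k * rate%:E * Lq_norm P (k%:R * q) (xi j1) ^+ k)%E.
Proof.
have meas V : measurable_fun setT
    (fun w => `|V - M%:R^-1 *: \sum_(j < M) sym_tensor_pow k (xi j w)|).
  apply: (bochner_measurable_family cP (phi := fun x : 'I_M -> E =>
    `|V - M%:R^-1 *: \sum_(j < M) sym_tensor_pow k (x j)|)) => // u a ua.
  apply: cvg_norm; apply: cvgB; first exact: cvg_cst.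
  apply: cvgZ; first exact: cvg_cst.
  apply: (cvg_big add_continuous) => j _.
  exact: sym_tensor_pow_cvg.
apply: le_trans (leeD2l _ SL_constant_rate).
apply: (Lq_norm_le_add P q_ge1 (normr_ge0 _)); [|exact: meas|exact: meas].
by move=> w; rewrite -[X in `|X|](subrKA (sym_inj_moment P k (xi j1))) ler_normD.
Qed.

End Rate.

Theorem corollary3p20 (R : realType) (d : measure_display)
    (Omega : measurableType d) (P : probability Omega R)
    (E : completeNormedModType R) (p q B : R) (k M : nat)
    (k_gt0 : (0 < k)%N) (M_gt0 : (0 < M)%N) (xi : 'I_M -> Omega -> E) :
  let xi1 := xi (Ordinal M_gt0) in
  let C := SL_constant E B q p k in
  let rate := M%:R `^ (- (1 - p^-1)) in
  measure_is_complete P ->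
  1 <= p <= 2 -> rademacher_type E p -> p <= q ->
  0 < B -> khintchine_bound q B ->
  (forall j, in_Lq P (k%:R * q) (xi j)) ->
  independent_rvs P xi -> identically_distributed P xi ->
  (forall U : sym_inj_tensor_power k E,
    (Lq_norm P q (fun w => (U - M%:R^-1 *: \sum_(j < M) sym_tensor_pow k (xi j w))%R)
     <= `|U - sym_inj_moment P k xi1|%:E
        + C * rate%:E * Lq_norm P (k%:R * q) xi1 ^+ k)%E) /\
  (forall eta : Omega -> E, in_Lq P k%:R eta ->
    (Lq_norm P q (fun w => (sym_inj_moment P k eta
         - M%:R^-1 *: \sum_(j < M) sym_tensor_pow k (xi j w))%R)
     <= Lq_norm P k%:R (fun w => (eta w - xi1 w)%R)
          * (\sum_(i < k) Lq_norm P k%:R eta ^+ i * Lq_norm P k%:R xi1 ^+ (k - i - 1))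
        + C * rate%:E * Lq_norm P (k%:R * q) xi1 ^+ k)%E).
Proof.
move=> xi1 C rate cP /andP[p1 _] tE pq B0 _ hxi indep ident.
have main := SL_rate cP k_gt0 M_gt0 p1 pq tE B0 (Ordinal M_gt0) hxi indep ident.
split=> // eta [beta /Lq_norm_lty heta]; apply: (le_trans (main _)); apply: leeD => //.
have [bxi1 _] := hxi (Ordinal M_gt0).
have q1 : 1 <= q by exact: le_trans pq.
have ieta : (\int[P]_w (`|eta w| ^+ k)%:E < +oo)%E.
  by rewrite -integral_powR_exp; apply: heta; rewrite ltr0n.
have ixi := Lq_norm_exp_integrable cP k_gt0 p1 pq hxi (Ordinal M_gt0).
have [A A0 [LA hA]] := Lq_norm_nat k_gt0 (integral_dist_lty cP beta bxi1 ieta ixi).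
have [B1 B10 [LB hB]] := Lq_norm_nat k_gt0 ieta.
have [B2 B20 [LC hC]] := Lq_norm_nat k_gt0 ixi.
apply: le_trans (sym_inj_moment_dist cP k_gt0 beta bxi1 ieta ixi) _.
have := sym_tensor_dist_integral cP k_gt0 beta bxi1 A0 B10 B20.
rewrite hA hB hC => /(_ (lexx _) (lexx _) (lexx _)) /le_trans; apply.
rewrite LA LB LC EFinM lee_wpmul2l ?lee_fin// /power_gap -sumEFin.
by apply: lee_sum => i _; rewrite EFinM !EFin_expe.
Qed.
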